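(* Let $(M^n,g,\nabla,\phi,\xi)$ be a quadratic metric $\phi$-hypersurface of a locally metallic Riemannian manifold $(\tilde M^{n+1},\tilde g,\tilde\nabla,J)$ with $J^2=pJ+qI$, and let $A$ be its shape operator and $R$ the Riemannian curvature tensor of $(M^n,g)$. Then $$R(X,Y)\xi=p\big((\nabla_XA)Y-(\nabla_YA)X\big)-\phi\big((\nabla_XA)Y-(\nabla_YA)X\big)$$ for all vector fields $X,Y\in\Gamma(TM)$.
   Context: A metallic structure on a manifold $\tilde M$ is a $(1,1)$-tensor field $J$ with $J^2=pJ+qI$, where $p,q$ are positive integers. $(\tilde M,\tilde g,J)$ is a metallic Riemannian manifold if $\tilde g$ is a Riemannian metric with $\tilde g(JX,Y)=\tilde g(X,JY)$ for all $X,Y$; it is locally metallic if in addition $\tilde\nabla J=0$ for the Levi-Civita connection $\tilde\nabla$ of $\tilde g$. A quadratic metric $\phi$-hypersurface is a hypersurface $M^n$ of $\tilde M^{n+1}$ with a globally defined unit normal vector field $\nu$, with induced metric $g$ and its Levi-Civita connection $\nabla$, together with a $(1,1)$-tensor field $\phi$, a unit tangent vector field $\xi$ and a $1$-form $\eta$ on $M^n$ such that, for all $X$ tangent to $M^n$, $$JX=\phi X+\eta(X)\nu,\qquad J\nu=q\xi+p\nu,\qquad J\xi=\nu,$$ with $\eta(\xi)=1$, $\eta\circ\phi=0$, and such that $(g,\phi,\eta,\xi)$ is an almost quadratic metric $\phi$-structure: $\phi\xi=0$, $\phi^2=p\phi+q(I-\eta\otimes\xi)$, $g(\phi X,Y)=g(X,\phi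 Y)$ and $g(\phi X,\phi Y)=p\,g(\phi X,Y)+q(g(X,Y)-\eta(X)\eta(Y))$. The shape operator $A$ is defined by $\tilde\nabla_X\nu=-AX$, so that $\tilde\nabla_XY=\nabla_XY+g(AX,Y)\nu$ for $X,Y$ tangent to $M^n$. Curvature convention: $R(X,Y)Z=\nabla_X\nabla_YZ-\nabla_Y\nabla_XZ-\nabla_{[X,Y]}Z$. *)

(* Defs.v *)
From HB Require Import structures.
From mathcomp Require Import all_boot all_order all_algebra.
From mathcomp Require Import all_classical all_reals all_analysis.

Set Implicit Arguments.
Unset Strict Implicit.
Unset Printing Implicit Defensive.

Import Order.TTheory GRing.Theory Num.Theory.
Import numFieldNormedType.Exports.
Local Open Scope classical_set_scope.
Local Open Scope ring_scope.

(* C^k and C^oo on an open subset U of a finite-dimensional space: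
   C^(k+1) means differentiable on U with every directional derivative
   x |-> df_x(v) of class C^k on U. *)
Fixpoint ck_on (R : realType) (V W : normedModType R) (k : nat) (U : set V)
    (f : V -> W) : Prop :=
  match k with
  | 0 => forall x, U x -> {for x, continuous f}
  | k'.+1 => (forall x, U x -> differentiable f x)
             /\ (forall v, ck_on k' U (fun x => 'd f x v))
  end.

Definition smooth_on (R : realType) (V W : normedModType R) (U : set V)
  (f : V -> W) : Prop := forall k, ck_on k U f.

(* The functions cfwd and cbwd are total; only their restrictions to the open
   sets cdom and cimg are meaningful, and these are inverse homeomorphisms. *)
Record chart (R : realType) (n : nat) (T : topologicalType) := Chart {
  cdom : set T;
  cimg : set 'rV[R]_n;
  cfwd : T -> 'rV[R]_n;
  cbwd : 'rV[R]_n -> T;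
  cdom_open : open cdom;
  cimg_open : open cimg;
  cfwd_img : forall x, cdom x -> cimg (cfwd x);
  cbwd_dom : forall y, cimg y -> cdom (cbwd y);
  cfwdK : forall x, cdom x -> cbwd (cfwd x) = x;
  cbwdK : forall y, cimg y -> cfwd (cbwd y) = y;
  cfwd_continuous : forall x, cdom x -> {for x, continuous cfwd};
  cbwd_continuous : forall y, cimg y -> {for y, continuous cbwd}
}.

(* The atlas need not be maximal.  The chosen chart chart_at x around x is used
   to identify the tangent space T_x M with 'rV[R]_n. *)
Record manifold (R : realType) (n : nat) := Manifold {
  mcarrier :> topologicalType;
  m_hausdorff : hausdorff_space mcarrier;
  m_second_countable : @second_countable mcarrier;
  atlas : set (chart R n mcarrier);
  chart_at : mcarrier -> chart R n mcarrier;
  chart_at_atlas : forall x, atlas (chart_at x);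
  chart_at_dom : forall x, cdom (chart_at x) x;
  atlas_compatible : forall c d, atlas c -> atlas d ->
    smooth_on (cimg c `&` cbwd c @^-1` cdom d) (cfwd d \o cbwd c)
}.

Section Calculus.
Context {R : realType}.

(* An element v : 'rV[R]_n regarded as a tangent vector at x is the list of
   components of that vector in the chart chart_at x.  Its components in an
   arbitrary chart c around x follow by the Jacobian of the transition map.
   Row vectors are used, so linear maps act on the right. *)
Definition coord n (M : manifold R n) (c : chart R n M) (x : M)
    (v : 'rV[R]_n) : 'rV[R]_n :=
  v *m 'J (cfwd c \o cbwd (chart_at x)) (cfwd (chart_at x) x).

Definition smooth_fun n (M : manifold R n) (U : set M) (h : M -> R) : Prop :=
  forall c, atlas c -> smooth_on (cimg c `&` cbwd c @^-1` U) (h \o cbwd c).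

(* dh_x(v) *)
Definition dfun n (M : manifold R n) (h : M -> R) (x : M) (v : 'rV[R]_n) : R :=
  'd (h \o cbwd (chart_at x)) (cfwd (chart_at x) x) v.

Definition smooth_map n m (M : manifold R n) (N : manifold R m)
    (F : M -> N) : Prop :=
  continuous F /\
  forall c d, atlas c -> atlas d ->
    smooth_on (cimg c `&` (F \o cbwd c) @^-1` cdom d)
              (cfwd d \o F \o cbwd c).

(* The differential T_x M -> T_(F x) N, acting on row vectors. *)
Definition dmap n m (M : manifold R n) (N : manifold R m) (F : M -> N)
    (x : M) : 'M[R]_(n, m) :=
  'J (cfwd (chart_at (F x)) \o F \o cbwd (chart_at x)) (cfwd (chart_at x) x).

(* Vector fields along F, i.e. sections of F^*TN: V x is in T_(F x) N.  They
   are total functions, with smoothness required on an open set U only, so that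
   sections over U are covered as well. *)
Definition smooth_along n m (M : manifold R n) (N : manifold R m) (F : M -> N)
    (U : set M) (V : M -> 'rV[R]_m) : Prop :=
  forall (c : chart R n M) (d : chart R m N), atlas c -> atlas d ->
    smooth_on (cimg c `&` cbwd c @^-1` (U `&` F @^-1` cdom d))
              (fun y => coord d (F (cbwd c y)) (V (cbwd c y))).

Definition smooth_vf n (M : manifold R n) (U : set M) (X : M -> 'rV[R]_n) :=
  smooth_along (N := M) id U X.

(* In coordinates, [X, Y]^k = X(Y^k) - Y(X^k). *)
Definition lie_bracket n (M : manifold R n) (X Y : M -> 'rV[R]_n) (x : M)
    : 'rV[R]_n :=
  let c := chart_at x in
  let rep (Z : M -> 'rV[R]_n) y := coord c (cbwd c y) (Z (cbwd c y)) in
  X x *m 'J (rep Y) (cfwd c x) - Y x *m 'J (rep X) (cfwd c x).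

(* A (1,1)-tensor field is given by its matrix on each T_x M = 'rV[R]_n,
   a 1-form by a column. *)
Definition smooth_tensor11 n (M : manifold R n) (T : M -> 'M[R]_n) : Prop :=
  forall U X, open U -> smooth_vf U X -> smooth_vf U (fun x => X x *m T x).

Definition form n (M : manifold R n) (eta : M -> 'cV[R]_n) (x : M)
    (v : 'rV[R]_n) : R := (v *m eta x) 0 0.

Definition smooth_form n (M : manifold R n) (eta : M -> 'cV[R]_n) : Prop :=
  forall U X, open U -> smooth_vf U X ->
    smooth_fun U (fun x => form eta x (X x)).

(* The metric is given by its Gram matrix on each tangent space. *)
Definition inner n (M : manifold R n) (g : M -> 'M[R]_n) (x : M)
    (v w : 'rV[R]_n) : R := (v *m g x *m w^T) 0 0.

Record riemannian n (M : manifold R n) (g : M -> 'M[R]_n) : Prop := {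
  riem_sym : forall x v w, inner g x v w = inner g x w v;
  riem_pos : forall x v, v != 0 -> 0 < inner g x v v;
  riem_smooth : forall U X Y, open U -> smooth_vf U X -> smooth_vf U Y ->
    smooth_fun U (fun x => inner g x (X x) (Y x))
}.

(* A connection on F^*TN, as a first-order operator from its (local) sections V
   to sections D V of T^*M (x) F^*TN: the covariant derivative of V in the
   direction v in T_x M is v *m D V x, so C^oo-linearity in the direction is
   built in.  For F = id this is an affine connection on M. *)
Record connection n m (M : manifold R n) (N : manifold R m) (F : M -> N)
    (D : (M -> 'rV[R]_m) -> M -> 'M[R]_(n, m)) : Prop := {
  conn_smooth : forall U X V, open U -> smooth_vf U X -> smooth_along F U V ->
    smooth_along F U (fun x => X x *m D V x);
  conn_add : forall U V W, open U -> smooth_along F U V ->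
    smooth_along F U W -> forall x, U x ->
    D (fun y => V y + W y) x = D V x + D W x;
  conn_leibniz : forall U h V, open U -> smooth_fun U h ->
    smooth_along F U V -> forall x v, U x ->
    v *m D (fun y => h y *: V y) x
      = dfun h x v *: V x + h x *: (v *m D V x)
}.

Definition cov n m (M : manifold R n)
    (D : (M -> 'rV[R]_m) -> M -> 'M[R]_(n, m)) (X : M -> 'rV[R]_n)
    (V : M -> 'rV[R]_m) : M -> 'rV[R]_m := fun x => X x *m D V x.

Record levi_civita n (M : manifold R n) (g : M -> 'M[R]_n)
    (nabla : (M -> 'rV[R]_n) -> M -> 'M[R]_n) : Prop := {
  lc_connection : connection (N := M) id nabla;
  lc_metric : forall U X Y Z, open U -> smooth_vf U X -> smooth_vf U Y ->
    smooth_vf U Z -> forall x, U x ->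
    dfun (fun y => inner g y (Y y) (Z y)) x (X x)
      = inner g x (cov nabla X Y x) (Z x) + inner g x (Y x) (cov nabla X Z x);
  lc_torsion_free : forall U X Y, open U -> smooth_vf U X -> smooth_vf U Y ->
    forall x, U x ->
    cov nabla X Y x - cov nabla Y X x = lie_bracket X Y x
}.

(* The connection F^*nabla on F^*TN induced by nabla on N, determined by
   (F^*nabla)_v (V o F) = nabla_(dF v) V. *)
Record pullback_connection n m (M : manifold R n) (N : manifold R m)
    (F : M -> N) (nabla : (N -> 'rV[R]_m) -> N -> 'M[R]_m)
    (D : (M -> 'rV[R]_m) -> M -> 'M[R]_(n, m)) : Prop := {
  pb_connection : connection F D;
  pb_comp : forall (U : set N) V, open U -> smooth_vf U V ->
    forall x, U (F x) -> D (V \o F) x = dmap F x *m nabla V (F x)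
}.

(* (nabla_X T) Y = nabla_X (T Y) - T (nabla_X Y) *)
Definition cov_tensor n (M : manifold R n)
    (nabla : (M -> 'rV[R]_n) -> M -> 'M[R]_n) (X : M -> 'rV[R]_n)
    (T : M -> 'M[R]_n) (Y : M -> 'rV[R]_n) : M -> 'rV[R]_n :=
  fun x => cov nabla X (fun y => Y y *m T y) x - cov nabla X Y x *m T x.

Definition curvature n (M : manifold R n)
    (nabla : (M -> 'rV[R]_n) -> M -> 'M[R]_n) (X Y Z : M -> 'rV[R]_n)
    : M -> 'rV[R]_n :=
  fun x => cov nabla X (cov nabla Y Z) x - cov nabla Y (cov nabla X Z) x
           - cov nabla (lie_bracket X Y) Z x.

Record metallic_riemannian m (N : manifold R m) (p q : nat)
    (g J : N -> 'M[R]_m) : Prop := {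
  mr_p_gt0 : (0 < p)%N;
  mr_q_gt0 : (0 < q)%N;
  mr_riemannian : riemannian g;
  mr_smooth : smooth_tensor11 J;
  mr_metallic : forall x, J x *m J x = p%:R *: J x + q%:R *: 1%:M;
  mr_compatible : forall x v w, inner g x (v *m J x) w = inner g x v (w *m J x)
}.

Record locally_metallic m (N : manifold R m) (p q : nat) (g J : N -> 'M[R]_m)
    (nabla : (N -> 'rV[R]_m) -> N -> 'M[R]_m) : Prop := {
  lm_metallic : metallic_riemannian p q g J;
  lm_levi_civita : levi_civita g nabla;
  lm_parallel : forall U X Y, open U -> smooth_vf U X -> smooth_vf U Y ->
    forall x, U x -> cov_tensor nabla X J Y x = 0
}.

Record isometric_immersion n m (M : manifold R n) (N : manifold R m)
    (g : M -> 'M[R]_n) (gN : N -> 'M[R]_m) (F : M -> N) : Prop := {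
  ii_smooth : smooth_map F;
  ii_immersion : forall x, row_free (dmap F x);
  ii_riemannian : riemannian g;
  ii_isometric : forall x v w,
    inner g x v w = inner gN (F x) (v *m dmap F x) (w *m dmap F x)
}.

Record unit_normal n m (M : manifold R n) (N : manifold R m)
    (gN : N -> 'M[R]_m) (F : M -> N) (nu : M -> 'rV[R]_m) : Prop := {
  un_smooth : smooth_along F setT nu;
  un_unit : forall x, inner gN (F x) (nu x) (nu x) = 1;
  un_normal : forall x v, inner gN (F x) (v *m dmap F x) (nu x) = 0
}.

Record almost_quadratic_metric n (M : manifold R n) (p q : nat)
    (g phi : M -> 'M[R]_n) (eta : M -> 'cV[R]_n) (xi : M -> 'rV[R]_n)
    : Prop := {
  aq_phi_smooth : smooth_tensor11 phi;
  aq_eta_smooth : smooth_form eta;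
  aq_xi_smooth : smooth_vf setT xi;
  aq_eta_xi : forall x, form eta x (xi x) = 1;
  aq_eta_phi : forall x v, form eta x (v *m phi x) = 0;
  aq_phi_xi : forall x, xi x *m phi x = 0;
  aq_phi2 : forall x v, v *m phi x *m phi x
    = p%:R *: (v *m phi x) + q%:R *: (v - form eta x v *: xi x);
  aq_sym : forall x v w,
    inner g x (v *m phi x) w = inner g x v (w *m phi x);
  aq_compatible : forall x v w, inner g x (v *m phi x) (w *m phi x)
    = p%:R * inner g x (v *m phi x) w
      + q%:R * (inner g x v w - form eta x v * form eta x w)
}.

Record quadratic_metric_phi_hypersurface n (M : manifold R n)
    (N : manifold R n.+1) (p q : nat) (gN J : N -> 'M[R]_n.+1) (F : M -> N)
    (nu : M -> 'rV[R]_n.+1) (g phi : M -> 'M[R]_n) (eta : M -> 'cV[R]_n)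
    (xi : M -> 'rV[R]_n) : Prop := {
  qh_immersion : isometric_immersion g gN F;
  qh_normal : unit_normal gN F nu;
  qh_structure : almost_quadratic_metric p q g phi eta xi;
  qh_xi_unit : forall x, inner g x (xi x) (xi x) = 1;
  qh_J_tangent : forall x v, v *m dmap F x *m J (F x)
    = v *m phi x *m dmap F x + form eta x v *: nu x;
  qh_J_nu : forall x, nu x *m J (F x)
    = q%:R *: (xi x *m dmap F x) + p%:R *: nu x;
  qh_J_xi : forall x, xi x *m dmap F x *m J (F x) = nu x
}.

(* D_v nu = - A v, where D is the connection of the ambient manifold pulled
   back along the immersion F. *)
Record shape_operator n m (M : manifold R n) (N : manifold R m) (F : M -> N)
    (D : (M -> 'rV[R]_m) -> M -> 'M[R]_(n, m)) (nu : M -> 'rV[R]_m)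
    (A : M -> 'M[R]_n) : Prop := {
  so_smooth : smooth_tensor11 A;
  so_weingarten : forall x (v : 'rV[R]_n), v *m D nu x = - (v *m A x *m dmap F x)
}.

End Calculus.

(* Main.v *)
Require Import Defs.
From HB Require Import structures.
From mathcomp Require Import all_boot all_order all_algebra.
From mathcomp Require Import all_classical all_reals all_analysis.
From mathcomp Require Import ring lra.
Import Order.TTheory GRing.Theory Num.Theory.
Import numFieldNormedType.Exports.
Local Open Scope classical_set_scope.
Local Open Scope ring_scope.

(** Write [g~] for the ambient metric, [F_*] for the differential of the
    immersion [F] and [D] for the pulled-back connection.

    The structure field is recovered from the normal by [J nu = q xi + p nu],
    so its covariant derivative can be read off from the Weingarten formula.
    As [J] is symmetric,
    [eta v = g~(J F_*v, nu) = g~(F_*v, J nu) = q g(v, xi)]; hence [q = 1], since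
    [eta xi = 1] and [xi] is a unit field.  Differentiating [J nu = q xi + p nu]
    with [J] parallel gives, by the formulas of Gauss and Weingarten,
    - the tangential part [nabla_v xi = p A v - phi (A v)];
    - the normal part [g(A v, xi) = - eta (A v)], which together with
      [eta = g(., xi)] forces [eta o A = 0].
    So [F_*(nabla_Y xi) = (p - J) F_*(A Y)] holds without any normal term, and
    can be differentiated once more: since [J] is parallel,
    [nabla_X nabla_Y xi = (p - phi) (nabla_X (A Y)) - g(A X, A Y) xi].
    The last term is symmetric in [X] and [Y] and disappears from
    [R(X, Y) xi]; writing [[X, Y] = nabla_X Y - nabla_Y X] in the remaining ones
    turns them into [(p - phi) ((nabla_X A) Y - (nabla_Y A) X)].

    The work is in the Gauss formula [gauss_formula].  All that is known of [D]
    is that it is a connection and what it does to fields [V o F].  In the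
    coordinate frame of a chart of the ambient manifold every field along [F]
    is a combination [\sum_i h_i (B_i o F)] with smooth [h_i], and so [D] is
    determined ([pullback_expand]).  From this expansion [D] inherits
    the parallelism of [J] ([pullback_parallel]), the compatibility with the
    metric ([pullback_metric]) and the symmetry
    [D_X F_*Y - D_Y F_*X = F_*[X, Y]] ([pullback_torsion]); the last one rests
    on the symmetry of second derivatives ([diff_sym]).  The tangential part of
    [D] on [M] is then metric and torsion-free, hence is the Levi-Civita
    connection of [g] ([gauss_tangential]). *)

Set Implicit Arguments.
Unset Strict Implicit.
Unset Printing Implicit Defensive.

Local Notation coord := Defs.coord.
Local Notation form := Defs.form.

(** * Differentials *)

Section DiffExtra.
Context {R : realType}.
Implicit Types V W : normedModType R.

(** The differential depends only on the germ: the first-order expansion of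
    [f] at [x] is also one of [g], and such an expansion is unique. *)
Lemma near_eq_diff V W (f g : V -> W) x : (\near x, f x = g x) ->
  differentiable f x -> differentiable g x /\ 'd g x = 'd f x :> (V -> W).
Proof.
move=> fg df; have [dfc dfo] := (diff_locallyP _ _).1 df.
have fgx : f x = g x by exact: nbhs_singleton fg.
have go : g \o shift x = cst (g x) + 'd f x +o_ 0 id.
  apply/eqaddoE/eqaddoP => _/posnumP[e].
  have /eqaddoP/(_ _ (gt0 e)) := dfo.
  move: fg; rewrite (near_shift 0 x) subr0 => fg.
  apply: filterS2 fg => y; rewrite !fctE/= => <-.
  by rewrite fgx.
have dgE : 'd g x = 'd f x :> (V -> W) by exact: diff_unique.
by split; [apply/diff_locallyP; rewrite dgE | exact: dgE].
Qed.

Fact scale_is_bilinear V :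
  bilinear_for
    (GRing.Scale.Law.clone _ _ *:%R _) (GRing.Scale.Law.clone _ _ *:%R _)
    (@GRing.scale R V : R -> V -> V).
Proof.
split=> [u'|u] a x y /=.
- by rewrite scalerDl scalerA.
- by rewrite scalerDr !scalerA mulrC.
Qed.

Lemma diff_scaling V W (h : V -> R) (f : V -> W) x :
  differentiable h x -> differentiable f x ->
  differentiable (fun y => h y *: f y) x /\
  'd (fun y => h y *: f y) x = (fun v => 'd h x v *: f x + h x *: 'd f x v)
    :> (V -> W).
Proof.
move=> dh df.
pose sM := bilinear_isBilinear.Build R R W W _ _ _ (scale_is_bilinear W).
pose s : {bilinear R -> W -> W} := HB.pack (@GRing.scale R W : R -> W -> W) sM.
have sc : continuous (fun p : R * W => s p.1 p.2) by exact: scale_continuous.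
have dp := differentiable_pair dh df.
have ds := differentiable_bilin (h x, f x) sc.
have E : (fun y => h y *: f y) = (fun p => s p.1 p.2) \o (fun y => (h y, f y)).
  by [].
rewrite E; split; first exact: differentiable_comp.
rewrite diff_comp // diff_bilin // diff_pair //.
by apply/funext => v /=; rewrite addrC.
Qed.

Lemma differentiable_mx V m n (f : V -> 'M[R]_(m, n)) x :
  differentiable f x -> forall i j, differentiable (fun y => f y i j) x.
Proof.
move=> df i j.
exact: (differentiable_comp df (differentiable_coord (f x) i j)).
Qed.

Lemma diff_mxE V m n (f : V -> 'M[R]_(m, n)) x v i j :
  differentiable f x -> 'd (fun y => f y i j) x v = 'd f x v i j.
Proof.
move=> df; rewrite -deriveE; last exact: differentiable_mx.
by rewrite -(deriveE v df) derive_mx ?mxE//; exact: diff_derivable.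
Qed.

Lemma mul_jacobian m n (f : 'rV[R]_m -> 'rV[R]_n) x v :
  v *m 'J f x = 'd f x v.
Proof. by rewrite /jacobian mul_rV_lin1. Qed.

Lemma jacobian_comp m n k (f : 'rV[R]_m -> 'rV[R]_n) (g : 'rV[R]_n -> 'rV[R]_k)
    x : differentiable f x -> differentiable g (f x) ->
  'J (g \o f) x = 'J f x *m 'J g (f x).
Proof.
move=> df dg; apply/row_matrixP => i; rewrite !rowE mulmxA !mul_jacobian.
by rewrite diff_comp.
Qed.

Lemma near_eq_jacobian m n (f g : 'rV[R]_m -> 'rV[R]_n) x :
  (\near x, f x = g x) -> differentiable f x -> 'J g x = 'J f x.
Proof.
move=> fg df; exact: (congr1 (@lin1_mx _ _ _) (near_eq_diff fg df).2).
Qed.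

Lemma jacobian_near_id n (f : 'rV[R]_n -> 'rV[R]_n) x :
  (\near x, f x = x) -> 'J f x = 1%:M.
Proof.
move=> fE; have idf : \near x, id x = f x by apply: filterS fE.
rewrite (near_eq_jacobian idf); last exact: ex_diff.
by apply/row_matrixP => i; rewrite !rowE mul_jacobian mulmx1 diff_val.
Qed.

End DiffExtra.

Section CkOn.
Context {R : realType}.
Implicit Types V W : normedModType R.

Lemma ck_on_continuous V W k (U : set V) (f : V -> W) :
  ck_on k U f -> forall x, U x -> {for x, continuous f}.
Proof.
by case: k => [//|k] [df _] x /df; exact: differentiable_continuous.
Qed.

Lemma ck_onW V W k (U : set V) (f : V -> W) : ck_on k.+1 U f -> ck_on k U f.
Proof.
elim: k f => [f Cf|k IHk f [df Cf]]; first exact: ck_on_continuous Cf.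
by split=> // v; exact: IHk.
Qed.

Lemma ck_on_subset V W k (U U' : set V) (f : V -> W) :
  U' `<=` U -> ck_on k U f -> ck_on k U' f.
Proof.
move=> sU; elim: k f => [f Cf x /sU|k IHk f [df Cf]]; first exact: Cf.
by split=> [x /sU|v]; [exact: df|apply: IHk; exact: Cf].
Qed.

(** The clauses of [ck_on] are pointwise in [U], so being of class C^k is a
    local property. *)
Lemma ck_on_local V W k (U : set V) (f : V -> W) :
  (forall x, U x -> exists2 U', U' x & ck_on k U' f) -> ck_on k U f.
Proof.
elim: k f => [f Cf x /Cf[U' U'x CU']|k IHk f Cf]; first exact: CU' x U'x.
split=> [x /Cf[U' U'x [df _]]|v]; first exact: df.
by apply: IHk => x /Cf[U' U'x [_ CU']]; exists U' => //; exact: CU'.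
Qed.

Lemma ck_on_eq V W k (U : set V) (f g : V -> W) : open U -> {in U, f =1 g} ->
  ck_on k U f -> ck_on k U g.
Proof.
move=> oU; have near_U x : U x -> \near x, U x by move=> ?; exact: open_nbhs_nbhs.
elim: k f g => [f g fg Cf x Ux|k IHk f g fg [df Cf]].
  have fgx : f x = g x by rewrite fg ?inE.
  rewrite /prop_for /continuous_at -fgx; apply: cvg_trans (Cf _ Ux).
  apply: near_eq_cvg; apply: filterS (near_U _ Ux) => y Uy.
  by rewrite fg ?inE.
have dE x : U x -> differentiable g x /\ 'd g x = 'd f x :> (V -> W).
  move=> Ux; apply: near_eq_diff; last exact: df.
  by apply: filterS (near_U _ Ux) => y Uy; rewrite fg ?inE.
split=> [x /dE[]//|v].
by apply: IHk (Cf v) => x; rewrite inE => /dE[_ ->].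
Qed.

Lemma ck_on_cst V W k (U : set V) (a : W) : ck_on k U (fun=> a).
Proof.
elim: k a => [a x _|k IHk a]; first exact: cvg_cst.
split=> [x _|v]; first exact: differentiable_cst.
have -> : (fun x : V => 'd (fun=> a) x v) = (fun=> 0); last exact: IHk.
by apply/funext => x; rewrite diff_cst.
Qed.

Lemma ck_onD V W k (U : set V) (f g : V -> W) : open U ->
  ck_on k U f -> ck_on k U g -> ck_on k U (fun x => f x + g x).
Proof.
move=> oU; elim: k f g => [f g Cf Cg x Ux|k IHk f g [df Cf] [dg Cg]].
  by apply: continuousD; [exact: Cf|exact: Cg].
split=> [x Ux|v]; first by apply: differentiableD; [exact: df|exact: dg].
apply: (ck_on_eq oU) (IHk _ _ (Cf v) (Cg v)) => x; rewrite inE => Ux.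
exact: (esym (congr1 (@^~ v) (diffD (df x Ux) (dg x Ux)))).
Qed.

Lemma ck_onZ V W k (U : set V) (h : V -> R) (f : V -> W) : open U ->
  ck_on k U h -> ck_on k U f -> ck_on k U (fun x => h x *: f x).
Proof.
move=> oU; elim: k h f => [h f Ch Cf x Ux|k IHk h f Ch Cf].
  by apply: cvgZ; [exact: Ch|exact: Cf].
have [[dh Ch'] [df Cf']] := (Ch, Cf).
split=> [x Ux|v].
  by have [] := diff_scaling (dh x Ux) (df x Ux).
have := ck_onD oU (IHk _ _ (Ch' v) (ck_onW Cf)) (IHk _ _ (ck_onW Ch) (Cf' v)).
apply: (ck_on_eq oU) => x; rewrite inE => Ux.
exact: (esym (congr1 (@^~ v) (diff_scaling (dh x Ux) (df x Ux)).2)).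
Qed.

Lemma ck_on_sum V W k n (U : set V) (f : 'I_n -> V -> W) : open U ->
  (forall i, ck_on k U (f i)) -> ck_on k U (fun x => \sum_i f i x).
Proof.
move=> oU Cf; elim: (index_enum _) => [|i r IHr].
  have -> : (fun x => \sum_(i <- [::]) f i x) = (fun=> 0 : W).
    by apply/funext => x; rewrite big_nil.
  exact: ck_on_cst.
have -> : (fun x => \sum_(i <- i :: r) f i x)
    = (fun x => f i x + \sum_(i <- r) f i x).
  by apply/funext => x; rewrite big_cons.
exact: ck_onD.
Qed.

Lemma ck_on_mxE V m n k (U : set V) (f : V -> 'M[R]_(m, n)) i j : open U ->
  ck_on k U f -> ck_on k U (fun x => f x i j).
Proof.
move=> oU; elim: k f => [f Cf x Ux|k IHk f [df Cf]].
  apply: (@continuous_comp _ _ _ f (fun M => M i j) x (Cf x Ux)).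
  exact: coord_continuous.
split=> [x Ux|v]; first by apply: differentiable_mx; exact: df.
apply: (ck_on_eq oU) (IHk _ (Cf v)) => x; rewrite inE => Ux.
by rewrite diff_mxE//; exact: df.
Qed.

Lemma linear_rV_sum W m (L : {linear 'rV[R]_m -> W}) w :
  L w = \sum_i w 0 i *: L (delta_mx 0 i).
Proof.
by rewrite [w in L w]row_sum_delta linear_sum; apply: eq_bigr => i _; rewrite linearZ.
Qed.

(** Induction on [k] needs the derivative of a composite as a combination of
    functions of class C^k; expanding [df_x(v)] in the canonical basis writes
    it as the sum of the products of the components of [df_x(v)] by the
    partial derivatives of [g] at [f x]. *)
Lemma ck_on_comp V W m k (U : set V) (O : set 'rV[R]_m)
    (f : V -> 'rV[R]_m) (g : 'rV[R]_m -> W) : open U ->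
    (forall x, U x -> O (f x)) ->
  ck_on k U f -> ck_on k O g -> ck_on k U (g \o f).
Proof.
move=> oU fUO; elim: k f fUO g => [f fUO g Cf Cg x Ux|k IHk f fUO g Cf Cg].
  by apply: continuous_comp; [exact: Cf|apply: Cg; exact: fUO].
have [[df Cf'] [dg Cg']] := (Cf, Cg).
split=> [x Ux|v].
  by apply: differentiable_comp; [exact: df|apply: dg; exact: fUO].
have /(ck_on_eq oU) : ck_on k U (fun x => \sum_i
    ('d f x v) 0 i *: ((fun y => 'd g y (delta_mx 0 i)) \o f) x).
  apply: ck_on_sum => // i; apply: ck_onZ => //; last first.
    by apply: IHk => //; [exact: ck_onW|exact: Cg'].
  by apply: ck_on_mxE => //; exact: Cf'.
apply=> x; rewrite inE => Ux.
rewrite [RHS](_ : _ = 'd g (f x) ('d f x v)); last first.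
  by rewrite diff_comp//; [exact: df|apply: dg; exact: fUO].
by rewrite [RHS]linear_rV_sum.
Qed.

End CkOn.

(* Unfolding two distinct differentials never makes them unify. *)
Local Opaque jacobian diff.

Section CkJacobian.
Context {R : realType}.

Lemma ck_on_id (V : normedModType R) k (U : set V) : ck_on k U id.
Proof.
case: k => [z _|k]; first exact: cvg_id.
split=> [z _|v]; first exact: ex_diff.
rewrite (_ : (fun y => _) = fun=> v); first exact: ck_on_cst.
by apply/funext => y; rewrite diff_val.
Qed.

Lemma ck_on_mul_jacobian (V : normedModType R) m n k (U : set V)
    (O : set 'rV[R]_m) (a : V -> 'rV[R]_m) (f : V -> 'rV[R]_m)
    (g : 'rV[R]_m -> 'rV[R]_n) :
  open U -> (forall x, U x -> O (f x)) ->
  ck_on k U a -> ck_on k U f -> ck_on k.+1 O g ->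
  ck_on k U (fun x => a x *m 'J g (f x)).
Proof.
move=> oU fUO Ca Cf [_ Cg].
have -> : (fun x => a x *m 'J g (f x)) = (fun x => \sum_i
    (a x) 0 i *: ((fun y => 'd g y (delta_mx 0 i)) \o f) x).
  by apply/funext => x; rewrite mul_jacobian; exact: linear_rV_sum.
apply: ck_on_sum => // i; apply: ck_onZ => //; first exact: ck_on_mxE.
by apply: (ck_on_comp oU fUO Cf); exact: Cg.
Qed.

End CkJacobian.

(** * Second derivatives *)

Section Schwarz.
Context {R : realType}.
Implicit Types V W : normedModType R.

Lemma is_derive_line V (f : V -> R) (a u : V) (s : R) :
  differentiable f (a + s *: u) ->
  is_derive s 1 (fun t : R => f (a + t *: u)) ('d f (a + s *: u) u).
Proof.
move=> df.
have dl : is_diff s (fun t : R => a + t *: u) (fun t => t *: u).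
  have -> : (fun t : R => t *: u) = 0 + (fun t => t *: u).
    by apply/funext => t; rewrite fctE/= add0r.
  by apply: is_diffD.
have dc := differentiable_comp (@ex_diff _ _ _ _ _ _ _ dl) df.
apply: DeriveDef; first exact: diff_derivable.
rewrite (deriveE (1 : R) dc) (diff_comp (@ex_diff _ _ _ _ _ _ _ dl) df) /=.
by rewrite (@diff_val _ _ _ _ _ _ _ dl) scale1r.
Qed.

(** The mean value theorem along the segment from [z] to [z + t u] turns the
    second difference into [t (g (z + s u + t w) - g (z + s u))] with [g y =
    df_y(u)] and [0 <= s <= t]; the differentiability of [g] at [z] alone then
    gives [t^2 dg_z(w)] up to o(t^2), as the contributions of [s u] cancel. *)
Lemma second_difference V (f : V -> R) (z u w : V) :
  (\near z, differentiable f z) -> differentiable (fun y => 'd f y u) z ->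
  forall e, 0 < e -> \forall t \near 0^'+,
    `|f (z + t *: u + t *: w) - f (z + t *: u) - f (z + t *: w) + f z
      - t ^+ 2 * 'd (fun y => 'd f y u) z w| <= e * t ^+ 2.
Proof.
move=> df; set g := fun y => 'd f y u => dg e e0.
(* The errors at s u + t w and at s u add up to t (2 |u| + |w|) e / K, with s
   <= t; the term 1 makes K positive. *)
pose K := 2 * `|u| + `|w| + 1.
have K0 : 0 < K by rewrite ltr_wpDl// addr_ge0// mulr_ge0.
have eK0 : 0 < e / K by rewrite divr_gt0.
have [dgc /eqaddoP/(_ _ eK0) go] := (diff_locallyP _ _).1 dg.
have df0 : \forall y \near (0 : V), differentiable f (y + z).
  by move: df; rewrite (near_shift 0 z) subr0.
have [d /= d0 dP] := (nbhs_ballP _ _).1 (filterI df0 go).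
have {go df0}dP y : `|y| < d -> differentiable f (y + z) /\
    `|g (z + y) - g z - 'd g z y| <= e / K * `|y|.
  move=> yd; have [|dfy gy] := dP y.
    by rewrite -ball_normE /= sub0r normrN.
  by split=> //; move: gy; rewrite !fctE/= opprD addrA [z + y]addrC.
near=> t.
have t0 : 0 < t by near: t; exact: nbhs_right_gt.
have td : t * K < d.
  rewrite -ltr_pdivlMr//; near: t; apply: nbhs_right_lt; exact: divr_gt0.
have small s : 0 <= s <= t -> `|s *: u + t *: w| < d /\ `|s *: u| < d.
  move=> /andP[s0 st]; split; apply: le_lt_trans td.
    rewrite (le_trans (ler_normD _ _))// !normrZ (ger0_norm s0) gtr0_norm//.
    rewrite /K; have := ler_wpM2r (normr_ge0 u) st.
    have := mulr_ge0 (ltW t0) (normr_ge0 u); nra.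
  rewrite normrZ (ger0_norm s0) /K; have := ler_wpM2r (normr_ge0 u) st.
  have := mulr_ge0 (ltW t0) (normr_ge0 u).
  have := mulr_ge0 (ltW t0) (normr_ge0 w); nra.
pose h s := f (z + t *: w + s *: u) - f (z + s *: u).
pose dh s := g (z + t *: w + s *: u) - g (z + s *: u).
have hD s : 0 <= s <= t -> is_derive s 1 h (dh s).
  move=> /small[s1 s2]; apply: is_deriveB; apply: is_derive_line.
    by have [+ _] := dP _ s1; rewrite addrC addrA addrAC.
  by have [+ _] := dP _ s2; rewrite addrC.
have [||s st hs] := @MVT R h dh 0 t t0.
- by move=> s /itvP st; apply: hD; rewrite !st.
- apply: derivable_within_continuous => s /itvP st.
  by have /(_ _)/@ex_derive := hD s; apply; rewrite !st.
have {}st : 0 <= s <= t by rewrite !(itvP st).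
have [s1 s2] := small s st.
have [_ b1] := dP _ s1; have [_ b2] := dP _ s2.
have -> : f (z + t *: u + t *: w) - f (z + t *: u) - f (z + t *: w) + f z
    = h t - h 0.
  by rewrite /h scale0r !addr0 (addrAC z (t *: u)); ring.
rewrite hs subr0 /dh.
have -> : z + t *: w + s *: u = z + (s *: u + t *: w) by rewrite -addrA [s *: u + _]addrC.
have nu : `|s *: u| <= t * `|u|.
  by case/andP: st => s0 st; rewrite normrZ ger0_norm// ler_wpM2r.
have nw : `|s *: u + t *: w| <= t * `|u| + t * `|w|.
  by rewrite (le_trans (ler_normD _ _))// lerD// normrZ gtr0_norm.
set a := g _ in b1 *; set b := g _ in b2 *.
rewrite linearD !linearZ /= in b1; rewrite linearZ /= in b2.
have {}b1 := le_trans b1 (ler_wpM2l (ltW eK0) nw).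
have {}b2 := le_trans b2 (ler_wpM2l (ltW eK0) nu).
set P := a - _ - _ in b1; set Q := b - _ - _ in b2.
have -> : (a - b) * t - t ^+ 2 * 'd g z w = t * (P - Q).
  have alg (a' b' c' p' q' s' t' : R) : (a' - b') * t' - t' ^+ 2 * q'
      = t' * (a' - c' - (s' * p' + t' * q') - (b' - c' - s' * p')) by ring.
  exact: alg.
rewrite normrM gtr0_norm// expr2 mulrCA ler_pM2l//.
apply: le_trans (ler_normB _ _) _; apply: le_trans (lerD b1 b2) _.
rewrite -mulrDr -[e in leRHS](@divfK _ K) ?gt_eqF// -[leRHS]mulrA ler_pM2l// /K.
lra.
Unshelve. all: by end_near. Qed.

(** The second difference is symmetric in [u] and [w], and by
    [second_difference] it determines both iterated derivatives. *)
Lemma diff_sym V (f : V -> R) (z u w : V) :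
  (\near z, differentiable f z) ->
  differentiable (fun y => 'd f y u) z -> differentiable (fun y => 'd f y w) z ->
  'd (fun y => 'd f y u) z w = 'd (fun y => 'd f y w) z u.
Proof.
move=> df du dw.
set a := LHS; set b := RHS.
apply/eqP; rewrite -subr_eq0 -normr_le0; apply/ler_addgt0Pr => e e0; rewrite add0r.
have e20 : 0 < e / 2 by exact: divr_gt0.
near (0 : R)^'+ => t.
have t0 : 0 < t by near: t; exact: nbhs_right_gt.
have : `|f (z + t *: u + t *: w) - f (z + t *: u) - f (z + t *: w) + f z
         - t ^+ 2 * a| <= e / 2 * t ^+ 2.
  by near: t; exact: second_difference.
have : `|f (z + t *: w + t *: u) - f (z + t *: w) - f (z + t *: u) + f z
         - t ^+ 2 * b| <= e / 2 * t ^+ 2.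
  by near: t; exact: second_difference.
rewrite (addrAC z (t *: w)).
set p := f (z + _ + _); set q := f (z + _); set r := f (z + _); set o := f z.
rewrite distrC => /lerD/[apply] H.
have t20 : 0 < t ^+ 2 by rewrite exprn_gt0.
rewrite -(ler_pM2r t20) -[X in _ * X <= _]gtr0_norm// -normrM.
have -> : (a - b) * t ^+ 2 = (t ^+ 2 * a - (p - r - q + o)) + (p - q - r + o - t ^+ 2 * b).
  ring.
apply: le_trans (ler_normD _ _) _.
by rewrite addrC (distrC (_ - r + o)) (distrC (_ * a)) (le_trans H)// -mulrDl -splitr.
Unshelve. all: by end_near. Qed.

End Schwarz.

Section SecondDerivativesRV.
Context {R : realType}.

Context {n m : nat}.
Implicit Types (a : 'rV[R]_n -> 'rV[R]_n) (f : 'rV[R]_n -> 'rV[R]_m).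

Lemma diff_bigsum (V W : normedModType R) k (h : 'I_k -> V -> W) z :
  (forall i, differentiable (h i) z) ->
  differentiable (fun y => \sum_i h i y) z /\
  forall v, 'd (fun y => \sum_i h i y) z v = \sum_i 'd (h i) z v.
Proof.
move=> dh.
suff : forall s : seq 'I_k, differentiable (fun y => \sum_(i <- s) h i y) z /\
    forall v, 'd (fun y => \sum_(i <- s) h i y) z v = \sum_(i <- s) 'd (h i) z v.
  by move=> /(_ (index_enum _)).
elim=> [|i s [IHs IHd]].
  rewrite (_ : (fun y => _) = cst 0); last first.
    by apply/funext => y; rewrite big_nil.
  split; first exact: differentiable_cst.
  move=> v; rewrite big_nil; exact: (congr1 (@^~ v) (diff_cst _ _)).
rewrite (_ : (fun y => _) = h i + (fun y => \sum_(j <- s) h j y)); last first.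
  by apply/funext => y; rewrite big_cons.
split; first exact: differentiableD (dh i) IHs.
move=> v; rewrite big_cons -IHd.
exact: (congr1 (@^~ v) (diffD (dh i) IHs)).
Qed.

(** Product rule for the components [a *m 'J f] of the push-forward of a
    vector field with components [a]. *)
Lemma diff_mul_jacobian a f z u :
  differentiable a z -> (forall w, differentiable (fun y => 'd f y w) z) ->
  differentiable (fun y => a y *m 'J f y) z /\
  'd (fun y => a y *m 'J f y) z u
  = 'd a z u *m 'J f z + 'd (fun y => 'd f y (a z)) z u.
Proof.
move=> da df.
pose e (i : 'I_n) : 'rV[R]_n := delta_mx 0 i.
have dai i := differentiable_mx da 0 i.
have dsc i := diff_scaling (dai i) (df (e i)).
have [ds dsE] := diff_bigsum (fun i => (dsc i).1).
have aJ : (fun y => \sum_i a y 0 i *: 'd f y (e i)) = (fun y => a y *m 'J f y).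
  by apply/funext => y; rewrite mul_jacobian; apply: esym; exact: linear_rV_sum.
have faz : (fun y => \sum_i a z 0 i *: 'd f y (e i)) = (fun y => 'd f y (a z)).
  by apply/funext => y; apply: esym; exact: linear_rV_sum.
have dfz i := differentiableZ (a z 0 i) (df (e i)).
have [_ dszE] := diff_bigsum dfz.
rewrite aJ in ds dsE; split; first exact: ds.
have {}dszE : 'd (fun y => 'd f y (a z)) z u
    = \sum_i a z 0 i *: 'd (fun y => 'd f y (e i)) z u.
  apply: etrans (congr1 (fun h : _ -> _ => 'd h z u) (esym faz)) _.
  apply: etrans (dszE u) _; apply: eq_bigr => i _.
  exact: (congr1 (@^~ u) (diffZ (a z 0 i) (df (e i)))).
have E : 'd a z u *m 'J f z = \sum_i 'd a z u 0 i *: 'd f z (e i).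
  apply: etrans (mul_jacobian _ _ _) _; exact: linear_rV_sum.
apply: etrans (dsE u) _; apply: esym.
apply: etrans (congr1 (+%R _) dszE) _.
apply: etrans (congr1 (+%R^~ _) E) _.
rewrite -big_split; apply: eq_bigr => i _.
apply: esym; apply: etrans (congr1 (@^~ u) (dsc i).2) _ => /=.
exact: (congr1 (fun t => t *: _ + _) (diff_mxE u 0 i da)).
Qed.

Lemma diff_sym_rV f z u w :
  (\near z, differentiable f z) -> (forall v, differentiable (fun y => 'd f y v) z) ->
  'd (fun y => 'd f y u) z w = 'd (fun y => 'd f y w) z u.
Proof.
move=> df d2f; apply/rowP => j.
have near_comp v : \forall y \near z, 'd f y v 0 j = 'd (fun x => f x 0 j) y v.
  by apply: filterS df => y dfy; rewrite (diff_mxE v 0 j dfy).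
have dv v := differentiable_mx (d2f v) 0 j.
have comp v v' : differentiable (fun y => 'd (fun x => f x 0 j) y v) z /\
  'd (fun y => 'd (fun x => f x 0 j) y v) z v' = 'd (fun y => 'd f y v) z v' 0 j.
  have [dc dE] := near_eq_diff (near_comp v) (dv v).
  split; first exact: dc.
  by rewrite dE (diff_mxE v' 0 j (d2f v)).
rewrite -(comp u w).2 -(comp w u).2.
apply: diff_sym; [|exact: (comp u w).1|exact: (comp w u).1].
by apply: filterS df => y dfy; exact: differentiable_mx.
Qed.

End SecondDerivativesRV.

(** * Charts, coordinates and coordinate fields *)

Section Charts.
Context {R : realType}.

Lemma open_chart_preimage n (T : topologicalType) (c : chart R n T) (U : set T) :
  open U -> open (cimg c `&` cbwd c @^-1` U).
Proof.
move=> oU; rewrite openE => z [cz Uz]; apply: filterI.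
  by apply: open_nbhs_nbhs; split; [exact: cimg_open|].
apply: (cbwd_continuous cz).
by apply: open_nbhs_nbhs; split.
Qed.

Section Maps.
Context {n m : nat} {M : manifold R n} {N : manifold R m} {F : M -> N}.
Hypothesis sF : smooth_map F.

Lemma open_smooth_preimage (U : set N) : open U -> open (F @^-1` U).
Proof. by move=> oU; have [+ _] := sF; rewrite continuousP => /(_ U oU). Qed.

Lemma smooth_map_differentiable (c : chart R n M) (d : chart R m N) z :
  atlas c -> atlas d -> cimg c z -> cdom d (F (cbwd c z)) ->
  differentiable (cfwd d \o F \o cbwd c) z.
Proof.
move=> ac ad cz dFz.
by have [/(_ z (conj cz dFz))] := sF.2 c d ac ad 1%N.
Qed.

Lemma near_chart (c : chart R n M) (d : chart R m N) z :
  cimg c z -> cdom d (F (cbwd c z)) ->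
  \forall y \near z, cimg c y /\ cdom d (F (cbwd c y)).
Proof.
move=> cz dFz; have /(open_chart_preimage (c := c)) oU := open_smooth_preimage (cdom_open d).
by apply: open_nbhs_nbhs; split; [exact: oU|].
Qed.

End Maps.

Lemma smooth_map_id n (M : manifold R n) : smooth_map (@id M).
Proof.
by split=> [x|c d ac ad]; [exact: cvg_id|exact: atlas_compatible].
Qed.

Section Jacobians.
Context {n m : nat} {M : manifold R n} {N : manifold R m} {F : M -> N}.
Hypothesis sF : smooth_map F.

Lemma jacobian_rechart_target (c : chart R n M) (d d' : chart R m N) z :
  atlas c -> atlas d -> atlas d' -> cimg c z ->
  cdom d (F (cbwd c z)) -> cdom d' (F (cbwd c z)) ->
  'J (cfwd d' \o F \o cbwd c) z =
  'J (cfwd d \o F \o cbwd c) z *m 'J (cfwd d' \o cbwd d) (cfwd d (F (cbwd c z))).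
Proof.
move=> ac ad ad' cz dz d'z.
have df := smooth_map_differentiable sF ac ad cz dz.
have dt : differentiable (cfwd d' \o cbwd d) (cfwd d (F (cbwd c z))).
  apply: (smooth_map_differentiable (smooth_map_id N) ad ad').
    exact: cfwd_img.
  by rewrite /= cfwdK.
rewrite -(jacobian_comp df dt); apply: near_eq_jacobian.
  apply: filterS (near_chart sF cz dz) => y [cy dy] /=.
  by rewrite cfwdK.
exact: differentiable_comp.
Qed.

Lemma jacobian_rechart_source (c c' : chart R n M) (d : chart R m N) z :
  atlas c -> atlas c' -> atlas d -> cimg c z ->
  cdom c' (cbwd c z) -> cdom d (F (cbwd c z)) ->
  'J (cfwd d \o F \o cbwd c) z =
  'J (cfwd c' \o cbwd c) z *m
    'J (cfwd d \o F \o cbwd c') (cfwd c' (cbwd c z)).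
Proof.
move=> ac ac' ad cz c'z dz.
have dt : differentiable (cfwd c' \o cbwd c) z.
  exact: (smooth_map_differentiable (smooth_map_id M) ac ac' cz).
have df : differentiable (cfwd d \o F \o cbwd c') (cfwd c' (cbwd c z)).
  apply: (smooth_map_differentiable sF ac' ad); first exact: cfwd_img.
  by rewrite cfwdK.
rewrite -(jacobian_comp dt df); apply: near_eq_jacobian.
  apply: filterS (near_chart (smooth_map_id M) cz c'z) => y [cy c'y] /=.
  by rewrite cfwdK.
exact: differentiable_comp.
Qed.

Lemma coord_dmap (c : chart R n M) (d : chart R m N) x v :
  atlas c -> atlas d -> cdom c x -> cdom d (F x) ->
  coord d (F x) (v *m dmap F x) =
  coord c x v *m 'J (cfwd d \o F \o cbwd c) (cfwd c x).
Proof.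
move=> ac ad cx dx; rewrite /coord /dmap.
set e := chart_at x; have ae : atlas e := chart_at_atlas x.
have ex : cdom e x := chart_at_dom x.
have eK : cbwd e (cfwd e x) = x by rewrite cfwdK.
have ze : cimg e (cfwd e x) by exact: cfwd_img.
have := @jacobian_rechart_target e (chart_at (F x)) d (cfwd e x).
rewrite eK => /(_ ae (chart_at_atlas _) ad ze (chart_at_dom _) dx) E1.
have := @jacobian_rechart_source e c d (cfwd e x).
rewrite eK => /(_ ae ac ad ze cx dx) E2.
exact: (etrans (esym (mulmxA _ _ _))
  (etrans (congr1 (mulmx v) (etrans (esym E1) E2)) (mulmxA _ _ _))).
Qed.

End Jacobians.

Section CoordFields.
Context {n : nat} {M : manifold R n}.

Lemma coord_change (c d : chart R n M) x v :
  atlas c -> atlas d -> cdom c x -> cdom d x ->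
  coord d x v = coord c x v *m 'J (cfwd d \o cbwd c) (cfwd c x).
Proof.
move=> ac ad cx dx; rewrite /coord.
set e := chart_at x; have ae : atlas e := chart_at_atlas x.
have ex : cdom e x := chart_at_dom x.
have eK : cbwd e (cfwd e x) = x by rewrite cfwdK.
have ze : cimg e (cfwd e x) by exact: cfwd_img.
have := @jacobian_rechart_source _ _ _ _ _ (smooth_map_id M) e c d (cfwd e x).
rewrite /= eK => /(_ ae ac ad ze cx dx) E2.
exact: (etrans (congr1 (mulmx v) E2) (mulmxA _ _ _)).
Qed.

Lemma jacobian_chart_id (c : chart R n M) x :
  cdom c x -> 'J (cfwd c \o cbwd c) (cfwd c x) = 1%:M.
Proof.
move=> cx; apply: jacobian_near_id.
have : nbhs (cfwd c x) (cimg c).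
  by apply: open_nbhs_nbhs; split; [exact: cimg_open|exact: cfwd_img].
by apply: filterS => z cz /=; rewrite cbwdK.
Qed.

Lemma coord_chart_at (x : M) (v : 'rV[R]_n) : coord (chart_at x) x v = v.
Proof. by rewrite /coord jacobian_chart_id ?mulmx1//; exact: chart_at_dom. Qed.

(** The field that has the constant components [u] in the chart [d]: these
    fields provide both the local frames and the local extensions of a single
    tangent vector. *)
Definition coord_field (d : chart R n M) (u : 'rV[R]_n) (x : M) : 'rV[R]_n :=
  u *m 'J (cfwd (chart_at x) \o cbwd d) (cfwd d x).

Lemma coord_coord_field (d d' : chart R n M) u x :
  atlas d -> atlas d' -> cdom d x -> cdom d' x ->
  coord d' x (coord_field d u x) = u *m 'J (cfwd d' \o cbwd d) (cfwd d x).
Proof.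
move=> ad ad' dx d'x; rewrite /coord /coord_field -mulmxA.
have := @jacobian_rechart_target _ _ _ _ _ (smooth_map_id M) d (chart_at x) d' (cfwd d x).
rewrite /= cfwdK// => /(_ ad (chart_at_atlas _) ad' (cfwd_img dx)).
by move=> /(_ (chart_at_dom _) d'x) <-.
Qed.

Lemma coord_fieldK (d : chart R n M) u x : atlas d -> cdom d x ->
  coord d x (coord_field d u x) = u.
Proof.
by move=> ad dx; rewrite coord_coord_field// jacobian_chart_id// mulmx1.
Qed.

Lemma coordK (d : chart R n M) v x : atlas d -> cdom d x ->
  coord_field d (coord d x v) x = v.
Proof.
move=> ad dx; rewrite -[RHS](coord_chart_at x).
by rewrite (coord_change _ ad (chart_at_atlas x) dx (chart_at_dom x)).
Qed.

Lemma coord_expand (d : chart R n M) v x : atlas d -> cdom d x ->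
  v = \sum_i (coord d x v) 0 i *: coord_field d (delta_mx 0 i) x.
Proof.
move=> ad dx; rewrite -[LHS](coordK _ ad dx) /coord_field.
rewrite {1}[coord d x v]row_sum_delta mulmx_suml.
by apply: eq_bigr => i _; rewrite -scalemxAl.
Qed.

Lemma smooth_coord_field (d : chart R n M) u : atlas d ->
  smooth_vf (cdom d) (coord_field d u).
Proof.
move=> ad c d' ac ad' k; set S := _ `&` _.
have oS : open S.
  by apply: open_chart_preimage; apply: openI; exact: cdom_open.
have Cf : ck_on k S (cfwd d \o cbwd c).
  apply: ck_on_subset (atlas_compatible ac ad k) => z [cz [dz _]].
  by split.
have fS z : S z -> (cimg d `&` cbwd d @^-1` cdom d') ((cfwd d \o cbwd c) z).
  move=> [cz [dz d'z]]; split; first exact: cfwd_img.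
  by rewrite /= cfwdK.
apply: (ck_on_eq oS _ (ck_on_mul_jacobian oS fS (@ck_on_cst _ _ _ k S u) Cf
  (atlas_compatible ad ad' k.+1))) => z; rewrite inE => -[cz [dz d'z]].
apply: esym; exact: coord_coord_field.
Qed.

(** Tangent vectors at [y] are recorded by their components in [chart_at y],
    so the coordinate fields of that very chart extend them. *)
Lemma coord_field_at (y : M) u :
  coord_field (chart_at y) u y = u.
Proof. by rewrite /coord_field jacobian_chart_id ?mulmx1//; exact: chart_at_dom. Qed.

End CoordFields.

End Charts.

(** * Smooth functions and smooth fields along a map *)

Section Along.
Context {R : realType}.

Lemma coordD n (M : manifold R n) (c : chart R n M) (x : M) v w :
  coord c x (v + w) = coord c x v + coord c x w.
Proof. exact: mulmxDl. Qed.

Lemma coordZ n (M : manifold R n) (c : chart R n M) (x : M) a v :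
  coord c x (a *: v) = a *: coord c x v.
Proof. by rewrite /coord -scalemxAl. Qed.

Lemma smooth_fun_subset n (M : manifold R n) (U U' : set M) h :
  U' `<=` U -> smooth_fun U h -> smooth_fun U' h.
Proof.
move=> sU sh c ac k; apply: ck_on_subset (sh c ac k) => z [cz Uz].
by split=> //; exact: sU.
Qed.

Lemma smooth_fun_cst n (M : manifold R n) (U : set M) (a : R) :
  smooth_fun U (fun=> a).
Proof. by move=> c ac k; exact: (@ck_on_cst _ _ _ k _ a). Qed.

Lemma smooth_fun_eq n (M : manifold R n) (U : set M) (h h' : M -> R) :
  open U -> {in U, h =1 h'} -> smooth_fun U h -> smooth_fun U h'.
Proof.
move=> oU hh' sh c ac k; apply: (ck_on_eq _ _ (sh c ac k)) => [|z].
  exact: open_chart_preimage.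
by rewrite inE => -[cz Uz] /=; apply: hh'; rewrite inE.
Qed.

Lemma smooth_fun_differentiable n (M : manifold R n) (U : set M) h x :
  smooth_fun U h -> U x ->
  differentiable (h \o cbwd (chart_at x)) (cfwd (chart_at x) x).
Proof.
move=> sh Ux; have cx := chart_at_dom x.
have [+ _] := sh _ (chart_at_atlas x) 1%N; apply.
by split; [exact: cfwd_img|rewrite /= cfwdK].
Qed.

Section AlongMap.
Context {n m : nat} {M : manifold R n} {N : manifold R m} {F : M -> N}.
Hypothesis sF : smooth_map F.

Let dom (c : chart R n M) (d : chart R m N) (U : set M) : set 'rV[R]_n :=
  cimg c `&` cbwd c @^-1` (U `&` F @^-1` cdom d).

Let open_dom c d U : open U -> open (dom c d U).
Proof.
move=> oU; apply: open_chart_preimage; apply: openI => //.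
by apply: open_smooth_preimage => //; exact: cdom_open.
Qed.

Lemma smooth_along_subset U U' V :
  U' `<=` U -> smooth_along F U V -> smooth_along F U' V.
Proof.
move=> sU sV c d ac ad k; apply: ck_on_subset (sV c d ac ad k) => z.
by move=> [cz [Uz dz]]; split=> //; split=> //; exact: sU.
Qed.

Lemma smooth_along_eq U V W : open U -> {in U, V =1 W} ->
  smooth_along F U V -> smooth_along F U W.
Proof.
move=> oU VW sV c d ac ad k.
apply: (ck_on_eq (@open_dom c d _ oU) _ (sV c d ac ad k)) => z.
by rewrite inE => -[cz [Uz dz]]; rewrite VW// inE.
Qed.

Lemma smooth_along_local U V :
  (forall x, U x -> exists U', [/\ open U', U' x & smooth_along F U' V]) ->
  smooth_along F U V.
Proof.
move=> sV c d ac ad k; apply: ck_on_local => z [cz [Uz dz]].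
have [U' [oU' U'z sU']] := sV _ Uz.
exists (cimg c `&` cbwd c @^-1` (U' `&` F @^-1` cdom d)) => //.
exact: sU'.
Qed.

Lemma smooth_along0 U : smooth_along F U (fun=> 0).
Proof.
move=> c d ac ad k.
rewrite (_ : (fun y => _) = fun=> 0); last first.
  by apply/funext => y; exact: mul0mx.
exact: ck_on_cst.
Qed.

Lemma smooth_alongD U V W : open U -> smooth_along F U V ->
  smooth_along F U W -> smooth_along F U (fun x => V x + W x).
Proof.
move=> oU sV sW c d ac ad k.
apply: (ck_on_eq (@open_dom c d _ oU) _
  (ck_onD (@open_dom c d _ oU) (sV c d ac ad k) (sW c d ac ad k))) => z _.
by rewrite coordD.
Qed.

Lemma smooth_alongZ U h V : open U -> smooth_fun U h ->
  smooth_along F U V -> smooth_along F U (fun x => h x *: V x).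
Proof.
move=> oU sh sV c d ac ad k.
have sh' : ck_on k (dom c d U) (h \o cbwd c).
  by apply: ck_on_subset (sh c ac k) => z [cz [Uz _]].
apply: (ck_on_eq (@open_dom c d _ oU) _
  (ck_onZ (@open_dom c d _ oU) sh' (sV c d ac ad k))) => z _.
by rewrite coordZ.
Qed.

Lemma smooth_along_sum U k (V : 'I_k -> M -> 'rV[R]_m) : open U ->
  (forall i, smooth_along F U (V i)) ->
  smooth_along F U (fun x => \sum_i V i x).
Proof.
move=> oU sV; elim: (index_enum _) => [|i r IHr].
  by apply: (smooth_along_eq oU _ (smooth_along0 U)) => x _; rewrite big_nil.
apply: (smooth_along_eq oU _ (smooth_alongD oU (sV i) IHr)) => x _.
by rewrite big_cons.
Qed.

Lemma smooth_along_comp (O : set N) V : open O -> smooth_vf O V ->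
  smooth_along F (F @^-1` O) (V \o F).
Proof.
move=> oO sV c d ac ad k.
have oS := @open_dom c d _ (open_smooth_preimage sF oO).
have Cf : ck_on k (dom c d (F @^-1` O)) (cfwd d \o F \o cbwd c).
  by apply: ck_on_subset (sF.2 c d ac ad k) => z [cz [_ dz]].
have fO z : dom c d (F @^-1` O) z ->
    (cimg d `&` cbwd d @^-1` (O `&` id @^-1` cdom d)) ((cfwd d \o F \o cbwd c) z).
  by move=> [cz [Oz dz]]; split; [exact: cfwd_img|rewrite /= cfwdK].
apply: (ck_on_eq oS _ (ck_on_comp oS fO Cf (sV d d ad ad k))) => z.
by rewrite inE => -[cz [Oz dz]] /=; rewrite cfwdK.
Qed.

(** In charts, the components of [F_* Y] are those of [Y] multiplied by the
    Jacobian matrix of [F]. *)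
Lemma smooth_along_push U Y : open U -> smooth_vf U Y ->
  smooth_along F U (fun x => Y x *m dmap F x).
Proof.
move=> oU sY c d ac ad k; have oS := @open_dom c d _ oU.
have sF' : ck_on k.+1 (dom c d U) (cfwd d \o F \o cbwd c).
  by apply: ck_on_subset (sF.2 c d ac ad k.+1) => z [cz [_ dz]].
have sY' : ck_on k (dom c d U) (fun y => coord c (cbwd c y) (Y (cbwd c y))).
  apply: ck_on_subset (sY c c ac ac k) => z [cz [Uz _]]; split=> //; split=> //.
  exact: cbwd_dom.
have idS z : dom c d U z -> dom c d U (id z) by [].
apply: (ck_on_eq oS _ (ck_on_mul_jacobian oS idS sY' (@ck_on_id _ _ k _) sF')) => z.
rewrite inE => -[cz [Uz dz]] /=.
by rewrite (coord_dmap sF _ ac ad (cbwd_dom cz) dz) cbwdK.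
Qed.

Lemma smooth_fun_coord U (d : chart R m N) V i : open U -> atlas d ->
  U `<=` F @^-1` cdom d -> smooth_along F U V ->
  smooth_fun U (fun x => coord d (F x) (V x) 0 i).
Proof.
move=> oU ad sU sV c ac k.
apply: ck_on_mxE; first exact: open_chart_preimage.
apply: ck_on_subset (sV c d ac ad k) => z [cz Uz].
by split=> //; split=> //; exact: sU.
Qed.

End AlongMap.

End Along.

(** * Directional derivatives of functions on a manifold *)

Section Derivations.
Context {R : realType}.

Section DFun.
Context {n : nat} {M : manifold R n}.
Implicit Types (U : set M) (h k : M -> R) (x : M).

Lemma dfun_eq U h k x v : open U -> {in U, h =1 k} -> smooth_fun U h ->
  U x -> dfun k x v = dfun h x v.
Proof.
move=> oU hk sh Ux; have cx := chart_at_dom x.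
have dh := smooth_fun_differentiable sh Ux.
have hk' : \forall z \near cfwd (chart_at x) x,
    (h \o cbwd (chart_at x)) z = (k \o cbwd (chart_at x)) z.
  have oS := open_chart_preimage (c := chart_at x) oU.
  have : nbhs (cfwd (chart_at x) x) (cimg (chart_at x) `&` cbwd (chart_at x) @^-1` U).
    apply: open_nbhs_nbhs; split; first exact: oS.
    by split; [exact: cfwd_img|rewrite /= cfwdK].
  by apply: filterS => z [cz Uz] /=; apply: hk; rewrite inE.
rewrite /dfun; exact: (congr1 (@^~ v) (near_eq_diff hk' dh).2).
Qed.

Lemma dfun_cst (a : R) x v : dfun (fun=> a) x v = 0.
Proof. by rewrite /dfun (@diff_cst _ _ _ a). Qed.

Lemma dfunD U h k x v : smooth_fun U h -> smooth_fun U k -> U x ->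
  dfun (fun y => h y + k y) x v = dfun h x v + dfun k x v.
Proof.
move=> sh sk Ux.
rewrite /dfun; exact: (congr1 (@^~ v) (diffD (smooth_fun_differentiable sh Ux)
                        (smooth_fun_differentiable sk Ux))).
Qed.

Lemma dfunM U h k x v : smooth_fun U h -> smooth_fun U k -> U x ->
  dfun (fun y => h y * k y) x v = dfun h x v * k x + h x * dfun k x v.
Proof.
move=> sh sk Ux; have := congr1 (@^~ v)
  (diff_scaling (smooth_fun_differentiable sh Ux)
    (smooth_fun_differentiable sk Ux)).2.
rewrite /= cfwdK//; exact: chart_at_dom.
Qed.

Lemma smooth_funD U h k : open U -> smooth_fun U h -> smooth_fun U k ->
  smooth_fun U (fun x => h x + k x).
Proof.
move=> oU sh sk c ac i.
exact: (ck_onD (open_chart_preimage oU) (sh c ac i) (sk c ac i)).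
Qed.

Lemma smooth_funM U h k : open U -> smooth_fun U h -> smooth_fun U k ->
  smooth_fun U (fun x => h x * k x).
Proof.
move=> oU sh sk c ac i.
exact: (ck_onZ (open_chart_preimage oU) (sh c ac i) (sk c ac i)).
Qed.

Lemma smooth_fun_sum U r (h : 'I_r -> M -> R) : open U ->
  (forall i, smooth_fun U (h i)) -> smooth_fun U (fun x => \sum_i h i x).
Proof.
move=> oU sh c ac i.
exact: (ck_on_sum (open_chart_preimage oU) (fun j => sh j c ac i)).
Qed.

Lemma dfun_sum U r (h : 'I_r -> M -> R) x v : open U ->
  (forall i, smooth_fun U (h i)) -> U x ->
  dfun (fun y => \sum_i h i y) x v = \sum_i dfun (h i) x v.
Proof.
move=> oU sh Ux.
suff : forall s : seq 'I_r, smooth_fun U (fun y => \sum_(i <- s) h i y) /\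
    dfun (fun y => \sum_(i <- s) h i y) x v = \sum_(i <- s) dfun (h i) x v.
  by move=> /(_ (index_enum _))[].
elim=> [|i s [IHs IHd]].
  rewrite big_nil (_ : (fun y => _) = fun=> 0); last first.
    by apply/funext => y; rewrite big_nil.
  by split; [exact: smooth_fun_cst|exact: dfun_cst].
rewrite big_cons (_ : (fun y => _) = fun y => h i y + \sum_(j <- s) h j y); last first.
  by apply/funext => y; rewrite big_cons.
split; first exact: smooth_funD.
by rewrite (dfunD _ (sh i) IHs Ux) IHd.
Qed.

End DFun.

Section DFunComp.
Context {n m : nat} {M : manifold R n} {N : manifold R m} {F : M -> N}.
Hypothesis sF : smooth_map F.

Lemma smooth_fun_comp (O : set N) k : open O -> smooth_fun O k ->
  smooth_fun (F @^-1` O) (k \o F).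
Proof.
move=> oO sk c ac i; apply: ck_on_local => z [cz Oz].
set d := chart_at (F (cbwd c z)).
have ad : atlas d := chart_at_atlas _.
have oS : open (cimg c `&` cbwd c @^-1` (F @^-1` (O `&` cdom d))).
  apply: open_chart_preimage; apply: (open_smooth_preimage sF).
  by apply: openI => //; exact: cdom_open.
exists (cimg c `&` cbwd c @^-1` (F @^-1` (O `&` cdom d))).
  by split=> //; split=> //; exact: chart_at_dom.
have Cf : ck_on i (cimg c `&` cbwd c @^-1` (F @^-1` (O `&` cdom d)))
    (cfwd d \o F \o cbwd c).
  by apply: ck_on_subset (sF.2 c d ac ad i) => y [cy [_ dy]].
have fO y : (cimg c `&` cbwd c @^-1` (F @^-1` (O `&` cdom d))) y ->
    (cimg d `&` cbwd d @^-1` O) ((cfwd d \o F \o cbwd c) y).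
  by move=> [cy [Oy dy]]; split; [exact: cfwd_img|rewrite /= cfwdK].
apply: (ck_on_eq oS _ (ck_on_comp oS fO Cf (sk d ad i))) => y.
by rewrite inE => -[cy [Oy dy]] /=; rewrite cfwdK.
Qed.

Lemma dfun_comp (O : set N) k x v : open O -> smooth_fun O k -> O (F x) ->
  dfun (k \o F) x v = dfun k (F x) (v *m dmap F x).
Proof.
move=> oO sk Ox; rewrite /dfun /dmap mul_jacobian.
set c := chart_at x; set d := chart_at (F x).
have cx : cdom c x := chart_at_dom x.
have dx : cdom d (F x) := chart_at_dom _.
have cz : cimg c (cfwd c x) by exact: cfwd_img.
have dFx : cdom d (F (cbwd c (cfwd c x))) by rewrite cfwdK.
have dF := smooth_map_differentiable sF (chart_at_atlas x) (chart_at_atlas (F x)) cz dFx.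
have dk := smooth_fun_differentiable sk Ox.
have eFx : (cfwd d \o F \o cbwd c) (cfwd c x) = cfwd d (F x) by rewrite /= cfwdK.
rewrite -/d -eFx in dk.
have kF : \forall z \near cfwd c x,
    ((k \o cbwd d) \o (cfwd d \o F \o cbwd c)) z = ((k \o F) \o cbwd c) z.
  by apply: filterS (near_chart sF cz dFx) => z [_ dz] /=; rewrite cfwdK.
have dc := differentiable_comp dF dk.
apply: etrans (congr1 (@^~ v) (near_eq_diff kF dc).2) _.
apply: etrans (congr1 (@^~ v) (diff_comp dF dk)) _ => /=.
by rewrite cfwdK.
Qed.

End DFunComp.

End Derivations.

(** * Connections along a map *)

Section ConnectionsAlongMaps.
Context {R : realType}.

Lemma mulmx_ext m n (A B : 'M[R]_(m, n)) :
  (forall v : 'rV_m, v *m A = v *m B) -> A = B.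
Proof. by move=> AB; apply/row_matrixP => i; rewrite !rowE. Qed.

Section Connection.
Context {n m : nat} {M : manifold R n} {N : manifold R m} {F : M -> N}.
Hypothesis sF : smooth_map F.
Context {D : (M -> 'rV[R]_m) -> M -> 'M[R]_(n, m)}.
Hypothesis cD : connection F D.

(** Locality without bump functions: the function equal to 0 on [U] and to 1
    elsewhere is smooth on [U], and [Z] is its product with itself, so that
    both terms of the Leibniz rule vanish on [U]. *)
Lemma conn_vanish U Z x : open U -> {in U, forall y, Z y = 0} -> U x -> D Z x = 0.
Proof.
move=> oU Z0 Ux; apply: mulmx_ext => v; rewrite mulmx0.
pose h y : R := if `[< U y >] then 0 else 1.
have hU : {in U, (fun=> 0 : R) =1 h}.
  by move=> y; rewrite inE => Uy; rewrite /h asboolT.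
have sh : smooth_fun U h by exact: smooth_fun_eq hU (smooth_fun_cst _ _).
have sZ : smooth_along F U Z.
  by apply: (smooth_along_eq sF oU _ (smooth_along0 U)) => y /Z0 ->.
have {1}-> : Z = (fun y => h y *: Z y).
  apply/funext => y; rewrite /h; case: asboolP => Uy; last by rewrite scale1r.
  by rewrite scale0r Z0 ?inE.
rewrite (conn_leibniz cD oU sh sZ _ Ux) Z0 ?inE// scaler0 add0r.
by rewrite /h asboolT// scale0r.
Qed.

Lemma conn_local U V W x : open U -> {in U, V =1 W} ->
  smooth_along F U V -> U x -> D W x = D V x.
Proof.
move=> oU VW sV Ux.
have -> : W = (fun y => V y + (W y - V y)) by apply/funext => y; rewrite addrC subrK.
have Z0 : {in U, forall y, W y - V y = 0} by move=> y Uy; rewrite VW// subrr.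
rewrite (conn_add cD oU sV _ Ux).
  by rewrite (@conn_vanish U (fun y => W y - V y) x)// addr0.
by apply: (smooth_along_eq sF oU _ (smooth_along0 U)) => y /Z0 ->.
Qed.

Lemma conn_sum U k (V : 'I_k -> M -> 'rV[R]_m) x : open U ->
  (forall i, smooth_along F U (V i)) -> U x ->
  D (fun y => \sum_i V i y) x = \sum_i D (V i) x.
Proof.
move=> oU sV Ux.
suff : forall s : seq 'I_k, smooth_along F U (fun y => \sum_(i <- s) V i y) /\
    D (fun y => \sum_(i <- s) V i y) x = \sum_(i <- s) D (V i) x.
  by move=> /(_ (index_enum _))[].
elim=> [|i s [IHs IHd]].
  rewrite big_nil (_ : (fun y => _) = fun=> 0); last first.
    by apply/funext => y; rewrite big_nil.
  by split; [exact: smooth_along0|exact: (@conn_vanish U)].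
rewrite big_cons (_ : (fun y => _) = fun y => V i y + \sum_(j <- s) V j y); last first.
  by apply/funext => y; rewrite big_cons.
split; first exact: smooth_alongD.
by rewrite (conn_add cD oU (sV i) IHs Ux) IHd.
Qed.

Lemma conn_scale U (a : R) V x : open U -> smooth_along F U V -> U x ->
  D (fun y => a *: V y) x = a *: D V x.
Proof.
move=> oU sV Ux; apply: mulmx_ext => v.
rewrite (conn_leibniz cD oU (smooth_fun_cst U a) sV v Ux) dfun_cst.
by rewrite scale0r add0r scalemxAr.
Qed.

End Connection.

Section PullbackFrame.
Context {n m : nat} {M : manifold R n} {N : manifold R m} {F : M -> N}.
Hypothesis sF : smooth_map F.
Context {nablaN : (N -> 'rV[R]_m) -> N -> 'M[R]_m}.
Context {D : (M -> 'rV[R]_m) -> M -> 'M[R]_(n, m)}.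
Hypothesis pD : pullback_connection F nablaN D.

(** This determines [D]: by locality it may be computed on a local expansion,
    where only the Leibniz rule and the value of [D] on the fields [B_i o F]
    are used. *)
Lemma pullback_expand (U : set M) (O : set N) k (h : 'I_k -> M -> R)
    (B : 'I_k -> N -> 'rV[R]_m) V x v :
  open U -> open O -> U `<=` F @^-1` O ->
  (forall i, smooth_fun U (h i)) -> (forall i, smooth_vf O (B i)) ->
  {in U, forall y, V y = \sum_i h i y *: B i (F y)} -> U x ->
  v *m D V x = \sum_i (dfun (h i) x v *: B i (F x)
    + h i x *: (v *m dmap F x *m nablaN (B i) (F x))).
Proof.
move=> oU oO UO sh sB VE Ux; have cD := pb_connection pD.
have sBF i : smooth_along F U (B i \o F).
  by apply: (smooth_along_subset UO); exact: smooth_along_comp.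
have shB i : smooth_along F U (fun y => h i y *: (B i \o F) y).
  exact: smooth_alongZ.
have VE' : {in U, (fun y => \sum_i h i y *: (B i \o F) y) =1 V}.
  by move=> y Uy; rewrite VE.
rewrite (conn_local sF cD oU VE' (smooth_along_sum sF oU shB) Ux).
rewrite (conn_sum sF cD oU shB Ux) mulmx_sumr.
apply: eq_bigr => i _.
rewrite (conn_leibniz cD oU (sh i) (sBF i) _ Ux).
by rewrite (pb_comp pD oO (sB i) (UO _ Ux)) !mulmxA.
Qed.

End PullbackFrame.

End ConnectionsAlongMaps.

(** * What the pulled-back connection inherits *)

Section Inner.
Context {R : realType}.
Context {n : nat} {M : manifold R n} {g : M -> 'M[R]_n}.
Implicit Types (x : M) (u v w : 'rV[R]_n).

Lemma innerDl x u v w : inner g x (u + v) w = inner g x u w + inner g x v w.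
Proof. by rewrite /inner !mulmxDl mxE. Qed.

Lemma innerDr x u v w : inner g x u (v + w) = inner g x u v + inner g x u w.
Proof. by rewrite /inner linearD mulmxDr mxE. Qed.

Lemma innerZl x a u w : inner g x (a *: u) w = a * inner g x u w.
Proof. by rewrite /inner -!scalemxAl mxE. Qed.

Lemma innerZr x a u w : inner g x u (a *: w) = a * inner g x u w.
Proof. by rewrite /inner linearZ -scalemxAr mxE. Qed.

Lemma innerNl x u w : inner g x (- u) w = - inner g x u w.
Proof. by rewrite -scaleN1r innerZl mulN1r. Qed.

Lemma innerNr x u w : inner g x u (- w) = - inner g x u w.
Proof. by rewrite -scaleN1r innerZr mulN1r. Qed.

Lemma inner_sum x k l (u : 'I_k -> 'rV[R]_n) (w : 'I_l -> 'rV[R]_n) :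
  inner g x (\sum_i u i) (\sum_j w j) = \sum_i \sum_j inner g x (u i) (w j).
Proof.
rewrite /inner !mulmx_suml summxE; apply: eq_bigr => i _.
by rewrite linear_sum mulmx_sumr summxE.
Qed.

End Inner.

Section LeviCivita.
Context {R : realType} {n : nat} {M : manifold R n} {g : M -> 'M[R]_n}.
Context {nabla : (M -> 'rV[R]_n) -> M -> 'M[R]_n}.
Hypothesis lc : levi_civita g nabla.

(** The components of coordinate fields are constant, so their Jacobian
    matrices are zero. *)
Lemma lie_bracket_coord_field (x : M) u w :
  let d := chart_at x in
  lie_bracket (coord_field d u) (coord_field d w) x = 0.
Proof.
move=> d; rewrite /lie_bracket -/d.
suff J0 v : 'J (fun y => coord d (cbwd d y) (coord_field d v (cbwd d y))) (cfwd d x) = 0.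
  by rewrite !J0 !mulmx0 subrr.
have near_cst : \forall y \near cfwd d x,
    v = coord d (cbwd d y) (coord_field d v (cbwd d y)).
  have : nbhs (cfwd d x) (cimg d).
    apply: open_nbhs_nbhs; split; first exact: cimg_open.
    exact/cfwd_img/chart_at_dom.
  apply: filterS => y dy.
  by rewrite coord_fieldK//; [exact: chart_at_atlas|exact: cbwd_dom].
rewrite (near_eq_jacobian near_cst); last exact: differentiable_cst.
apply: mulmx_ext => t; rewrite mul_jacobian mulmx0.
exact: (congr1 (@^~ t) (diff_cst _ _)).
Qed.

(** The symmetry of the Christoffel symbols: torsion-freeness for coordinate
    fields, which commute. *)
Lemma christoffel_sym (x : M) u w :
  let d := chart_at x in
  u *m nabla (coord_field d w) x = w *m nabla (coord_field d u) x.
Proof.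
move=> d; have ad : atlas d := chart_at_atlas x.
have := lc_torsion_free lc (cdom_open d) (smooth_coord_field u ad)
  (smooth_coord_field w ad) (chart_at_dom x).
by rewrite lie_bracket_coord_field /cov !coord_field_at => /subr0_eq.
Qed.

End LeviCivita.

Section Pullback.
Context {R : realType} {n m : nat} {M : manifold R n} {N : manifold R m}.
Context {F : M -> N}.
Hypothesis sF : smooth_map F.
Context {nablaN : (N -> 'rV[R]_m) -> N -> 'M[R]_m}.
Context {D : (M -> 'rV[R]_m) -> M -> 'M[R]_(n, m)}.
Hypothesis pD : pullback_connection F nablaN D.

(** The expansion [pullback_expand] in the coordinate frame of the chart that
    identifies the tangent space at [F x], where the frame is the canonical
    basis. *)
Lemma pullback_coord (U : set M) V x (v : 'rV[R]_n) : open U -> smooth_along F U V -> U x ->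
  let d := chart_at (F x) in
  v *m D V x = \sum_i
    (dfun (fun y => coord d (F y) (V y) 0 i) x v *: delta_mx 0 i
     + V x 0 i *: (v *m dmap F x *m nablaN (coord_field d (delta_mx 0 i)) (F x))).
Proof.
move=> oU sV Ux d; have ad : atlas d := chart_at_atlas _.
pose U' := U `&` F @^-1` cdom d.
have oU' : open U'.
  by apply: openI => //; apply: (open_smooth_preimage sF); exact: cdom_open.
have U'x : U' x by split => //; exact: chart_at_dom.
have sU' : U' `<=` F @^-1` cdom d by move=> y [].
have sV' : smooth_along F U' V by apply: smooth_along_subset sV => y [].
have VE : {in U', forall y, V y = \sum_i coord d (F y) (V y) 0 i
    *: coord_field d (delta_mx 0 i) (F y)}.
  by move=> y; rewrite inE => -[_ dy]; exact: coord_expand.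
rewrite (pullback_expand sF pD v oU' (cdom_open d) sU'
  (fun i => smooth_fun_coord i oU' ad sU' sV')
  (fun i => smooth_coord_field (delta_mx 0 i) ad) VE U'x).
by apply: eq_bigr => i _; rewrite coord_field_at coord_chart_at.
Qed.

Section Parallel.
Context {T : N -> 'M[R]_m}.
Hypothesis sT : smooth_tensor11 T.

Lemma smooth_along_tensor U V : open U -> smooth_along F U V ->
  smooth_along F U (fun y => V y *m T (F y)).
Proof.
move=> oU sV; apply: smooth_along_local => x Ux.
set d := chart_at (F x); have ad : atlas d := chart_at_atlas _.
pose U' := U `&` F @^-1` cdom d.
have oU' : open U'.
  by apply: openI => //; apply: (open_smooth_preimage sF); exact: cdom_open.
exists U'; split => //; first by split => //; exact: chart_at_dom.
have sU' : U' `<=` F @^-1` cdom d by move=> y [].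
have sV' : smooth_along F U' V by apply: smooth_along_subset sV => y [].
pose B i y := coord_field d (delta_mx 0 i) y *m T y.
have sB i : smooth_along F U' (B i \o F).
  apply: (smooth_along_subset sU'); apply: (smooth_along_comp sF (cdom_open d)).
  by apply: sT; [exact: cdom_open|exact: smooth_coord_field].
apply: (smooth_along_eq sF oU' _ (smooth_along_sum sF oU' (fun i =>
  smooth_alongZ sF oU' (smooth_fun_coord i oU' ad sU' sV') (sB i)))).
move=> y; rewrite inE => -[_ dy].
rewrite [in RHS](coord_expand (V y) ad dy) mulmx_suml.
by apply: eq_bigr => i _; rewrite -scalemxAl.
Qed.

Hypothesis parT : forall U X Y, open U -> smooth_vf U X -> smooth_vf U Y ->
  forall y, U y -> cov_tensor nablaN X T Y y = 0.

(** If [E_i] is a coordinate frame and [V = \sum_i h_i (E_i o F)], then [T V =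
    \sum_i h_i (T E_i o F)], and [nabla (T E_i) = T (nabla E_i)] as [T] is
    parallel. *)
Lemma pullback_parallel (U : set M) V x (v : 'rV[R]_n) :
  open U -> smooth_along F U V -> U x ->
  v *m D (fun y => V y *m T (F y)) x = v *m D V x *m T (F x).
Proof.
move=> oU sV Ux.
set d := chart_at (F x); have ad : atlas d := chart_at_atlas _.
pose U' := U `&` F @^-1` cdom d.
have oU' : open U'.
  by apply: openI => //; apply: (open_smooth_preimage sF); exact: cdom_open.
have U'x : U' x by split => //; exact: chart_at_dom.
have sU' : U' `<=` F @^-1` cdom d by move=> y [].
have sV' : smooth_along F U' V by apply: smooth_along_subset sV => y [].
pose B i y := coord_field d (delta_mx 0 i) y *m T y.
have sB i : smooth_vf (cdom d) (B i).
  by apply: sT; [exact: cdom_open|exact: smooth_coord_field].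
have VE : {in U', forall y, V y *m T (F y)
    = \sum_i coord d (F y) (V y) 0 i *: B i (F y)}.
  move=> y; rewrite inE => -[_ dy].
  rewrite [in LHS](coord_expand (V y) ad dy) mulmx_suml.
  by apply: eq_bigr => i _; rewrite -scalemxAl.
rewrite (pullback_expand sF pD v oU' (cdom_open d) sU'
  (fun i => smooth_fun_coord i oU' ad sU' sV') sB VE U'x).
rewrite (pullback_coord v oU sV Ux) mulmx_suml; apply: eq_bigr => i _.
rewrite mulmxDl -!scalemxAl coord_chart_at /B coord_field_at; congr (_ + _ *: _).
set w := v *m _.
have := parT (cdom_open d) (smooth_coord_field w ad)
  (smooth_coord_field (delta_mx 0 i) ad) (chart_at_dom (F x)).
by rewrite /cov_tensor /cov coord_field_at => /subr0_eq.
Qed.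

End Parallel.

Section Metric.
Context {gN : N -> 'M[R]_m}.
Hypotheses (rgN : riemannian gN) (lc : levi_civita gN nablaN).

(** In a coordinate frame [inner gN V W] is a sum of products of components of
    [V], components of [W] and entries of the Gram matrix composed with [F];
    the derivatives of the latter are given by the metric compatibility of
    [nablaN]. *)
Lemma pullback_metric (U : set M) V W x (v : 'rV[R]_n) :
  open U -> smooth_along F U V -> smooth_along F U W -> U x ->
  dfun (fun y => inner gN (F y) (V y) (W y)) x v
  = inner gN (F x) (v *m D V x) (W x) + inner gN (F x) (V x) (v *m D W x).
Proof.
move=> oU sV sW Ux.
rewrite (pullback_coord v oU sV Ux) (pullback_coord v oU sW Ux).
set d := chart_at (F x); have ad : atlas d := chart_at_atlas _.
pose U' := U `&` F @^-1` cdom d.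
have oU' : open U'.
  by apply: openI => //; apply: (open_smooth_preimage sF); exact: cdom_open.
have U'x : U' x by split => //; exact: chart_at_dom.
have sU' : U' `<=` F @^-1` cdom d by move=> y [].
have sV' : smooth_along F U' V by apply: smooth_along_subset sV => y [].
have sW' : smooth_along F U' W by apply: smooth_along_subset sW => y [].
pose E i := coord_field d (delta_mx 0 i).
have sE i : smooth_vf (cdom d) (E i) by exact: smooth_coord_field.
pose G i j y := inner gN y (E i y) (E j y).
have sG i j : smooth_fun (cdom d) (G i j).
  by apply: (riem_smooth rgN) => //; exact: cdom_open.
have sGF i j : smooth_fun U' (G i j \o F).
  by apply: (smooth_fun_subset sU'); apply: smooth_fun_comp => //; exact: cdom_open.
pose h i y := coord d (F y) (V y) 0 i.
pose k i y := coord d (F y) (W y) 0 i.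
have sh i : smooth_fun U' (h i) by exact: smooth_fun_coord.
have sk i : smooth_fun U' (k i) by exact: smooth_fun_coord.
have shk i j := smooth_funM oU' (sh i) (sk j).
have shkG i j := smooth_funM oU' (shk i j) (sGF i j).
have innerE : {in U', (fun y => \sum_i \sum_j h i y * k j y * (G i j \o F) y)
    =1 (fun y => inner gN (F y) (V y) (W y))}.
  move=> y; rewrite inE => -[_ dy].
  rewrite [in RHS](coord_expand (V y) ad dy) [in RHS](coord_expand (W y) ad dy).
  rewrite inner_sum; apply: eq_bigr => i _; apply: eq_bigr => j _.
  by rewrite innerZl innerZr mulrA.
have ssum i := smooth_fun_sum oU' (fun j => shkG i j).
rewrite (dfun_eq v oU' innerE (smooth_fun_sum oU' ssum) U'x).
rewrite (dfun_sum v oU' ssum U'x).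
have hx i : h i x = V x 0 i by rewrite /h coord_chart_at.
have kx i : k i x = W x 0 i by rewrite /k coord_chart_at.
rewrite [X in inner _ _ _ X + _](row_sum_delta (W x)).
rewrite [X in _ + inner _ _ X _](row_sum_delta (V x)) !inner_sum.
rewrite -big_split; apply: eq_bigr => i _ /=.
rewrite (dfun_sum v oU' (shkG i) U'x) -big_split; apply: eq_bigr => j _ /=.
rewrite (dfunM v (shk i j) (sGF i j) U'x) (dfunM v (sh i) (sk j) U'x).
rewrite (dfun_comp sF v (cdom_open d) (sG i j)); last exact: chart_at_dom.
set w := v *m dmap F x.
have := lc_metric lc (cdom_open d) (smooth_coord_field w ad) (sE i) (sE j)
  (chart_at_dom (F x)).
rewrite /cov coord_field_at -/(G i j) => ->.
rewrite hx kx /G /= /E !coord_field_at.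
rewrite innerDl innerDr !(innerZl, innerZr).
have alg (a b e f p q r : R) : (a * b + e * f) * p + e * b * (q + r)
    = a * (b * p) + e * (b * q) + (e * (f * p) + e * (b * r)) by ring.
exact: alg.
Qed.

End Metric.

Section Torsion.
Context {gN : N -> 'M[R]_m}.
Hypothesis lc : levi_civita gN nablaN.

(** With [f] the expression of [F] in charts, the components of [F_* Y] are [Y
    *m 'J f].  Their derivative along [X] has a part with the derivative of
    [Y], which antisymmetrizes to [F_*[X, Y]], and a second derivative of [f],
    which is symmetric; the Christoffel terms are symmetric as well. *)
Lemma pullback_torsion (U : set M) X Y x :
  open U -> smooth_vf U X -> smooth_vf U Y -> U x ->
  X x *m D (fun y => Y y *m dmap F y) x - Y x *m D (fun y => X y *m dmap F y) x
  = lie_bracket X Y x *m dmap F x.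
Proof.
move=> oU sX sY Ux.
have sFX := smooth_along_push sF oU sX; have sFY := smooth_along_push sF oU sY.
rewrite (pullback_coord (X x) oU sFY Ux) (pullback_coord (Y x) oU sFX Ux).
set d := chart_at (F x); have ad : atlas d := chart_at_atlas _.
set c := chart_at x; have ac : atlas c := chart_at_atlas _.
set z := cfwd c x; have cx : cdom c x := chart_at_dom _.
have cz : cimg c z by exact: cfwd_img.
have zx : cbwd c z = x by rewrite /z cfwdK.
have dx : cdom d (F x) := chart_at_dom _.
have dz : cdom d (F (cbwd c z)) by rewrite zx.
pose f := cfwd d \o F \o cbwd c.
pose rep (Z : M -> 'rV[R]_n) y := coord c (cbwd c y) (Z (cbwd c y)).
have sf : smooth_on (cimg c `&` (F \o cbwd c) @^-1` cdom d) f by exact: sF.2.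
have d2f w : differentiable (fun y => 'd f y w) z.
  by have [_ /(_ w)[+ _]] := sf 2%N; apply.
have near_df : \near z, differentiable f z.
  apply: filterS (near_chart sF cz dz) => y [cy dy].
  exact: smooth_map_differentiable.
have drep Z : smooth_vf U Z -> differentiable (rep Z) z.
  by move=> sZ; have [+ _] := sZ c c ac ac 1%N; apply; split=> //; split; rewrite ?zx.
have repz Z : rep Z z = Z x by rewrite /rep zx coord_chart_at.
(* The components of F_* Z in the chart d, differentiated along u by the
   product rule. *)
have key Z u : smooth_vf U Z ->
  \row_i dfun (fun y => coord d (F y) (Z y *m dmap F y) 0 i) x u
  = u *m 'J (rep Z) z *m 'J f z + 'd (fun y => 'd f y (Z x)) z u.
  move=> sZ; have [dm dmE] := diff_mul_jacobian u (drep Z sZ) d2f.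
  rewrite (mul_jacobian (rep Z) z u) -(repz Z) -dmE.
  have near_rep : \forall y \near z, rep Z y *m 'J f y
      = coord d (F (cbwd c y)) (Z (cbwd c y) *m dmap F (cbwd c y)).
    apply: filterS (near_chart sF cz dz) => y [cy dy].
    by rewrite (coord_dmap sF _ ac ad (cbwd_dom cy) dy) cbwdK.
  have [dr drE] := near_eq_diff near_rep dm.
  apply/rowP => i; rewrite mxE.
  apply: etrans (diff_mxE u 0 i dr) _.
  exact: (congr1 (fun t : 'rV[R]_m => t 0 i) (congr1 (@^~ u) drE)).
pose b Z u i := dfun (fun y => coord d (F y) (Z y *m dmap F y) 0 i) x u.
have split_row Z u (B : 'I_m -> 'rV[R]_m) :
    \sum_i (b Z u i *: delta_mx 0 i + B i)
    = \row_i b Z u i + \sum_i B i.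
  rewrite big_split; congr (_ + _); rewrite [RHS]row_sum_delta.
  by apply: eq_bigr => i _; rewrite mxE.
rewrite !split_row !key//.
have sym2 (u w : 'rV[R]_m) : \sum_i u 0 i *: (w *m nablaN (coord_field d (delta_mx 0 i)) (F x))
    = \sum_i w 0 i *: (u *m nablaN (coord_field d (delta_mx 0 i)) (F x)).
  have dbl (s t : 'rV[R]_m) : \sum_i s 0 i *: (t *m nablaN (coord_field d (delta_mx 0 i)) (F x))
    = \sum_i \sum_j s 0 i *: (t 0 j *:
        (delta_mx 0 j *m nablaN (coord_field d (delta_mx 0 i)) (F x))).
    apply: eq_bigr => i _; rewrite {1}(row_sum_delta t) mulmx_suml scaler_sumr.
    by apply: eq_bigr => j _; rewrite -scalemxAl.
  rewrite !dbl exchange_big; apply: eq_bigr => i _; apply: eq_bigr => j _.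
  by rewrite (christoffel_sym lc) !scalerA mulrC.
rewrite (sym2 (Y x *m dmap F x)).
have cancel (a e p p' s : 'rV[R]_m) : p = p' ->
    a + p + s - (e + p' + s) = a - e.
  by move=> ->; rewrite opprD addrACA subrr addr0 opprD addrACA subrr addr0.
apply: etrans (cancel _ _ _ _ _ (diff_sym_rV (Y x) (X x) near_df d2f)) _.
by rewrite /lie_bracket mulmxBl.
Qed.

End Torsion.

End Pullback.

(** * The Gauss formula *)

Section Hypersurface.
Context {R : realType} {n : nat} {M : manifold R n} {N : manifold R n.+1}.
Context {g : M -> 'M[R]_n} {gN : N -> 'M[R]_n.+1} {F : M -> N}.
Context {nu : M -> 'rV[R]_n.+1}.
Hypothesis iF : isometric_immersion g gN F.
Hypothesis nF : unit_normal gN F nu.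
Hypothesis rgN : riemannian gN.

Let sF : smooth_map F := ii_smooth iF.

Lemma tangent_normal_inj x (u u' : 'rV[R]_n) (a a' : R) :
  u *m dmap F x + a *: nu x = u' *m dmap F x + a' *: nu x -> u = u' /\ a = a'.
Proof.
move=> E; have aa' : a = a'.
  have := congr1 (fun t => inner gN (F x) t (nu x)) E.
  by rewrite !innerDl !innerZl !(un_normal nF) !(un_unit nF) !add0r !mulr1.
split=> //; apply: (row_free_inj (ii_immersion iF x)).
by move: E; rewrite aa' => /addIr.
Qed.

(** The place where [M] has codimension one: a basis of a tangent space of
    [M], together with the normal, has as many vectors as the dimension of
    [N]. *)
Lemma tangent_normal_decomp x (w : 'rV[R]_n.+1) :
  exists u a, w = u *m dmap F x + a *: nu x.
Proof.
pose B := col_mx (dmap F x) (nu x).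
have mulB (u : 'rV_n) (t : 'rV_1) : row_mx u t *m B = u *m dmap F x + t 0 0 *: nu x.
  by rewrite mul_row_col {1}(mx11_scalar t) mul_scalar_mx.
have fB : row_full B.
  have : row_free B.
    apply: inj_row_free => v; rewrite -[v]hsubmxK mulB => vB0.
    have [|-> t0] := @tangent_normal_inj x (lsubmx v) 0 (rsubmx v 0 0) 0.
      by rewrite vB0 mul0mx scale0r addr0.
    by rewrite [rsubmx v]mx11_scalar t0 raddf0 row_mx0.
  by rewrite /row_free /row_full => /eqP ->; rewrite addn1.
have /submxP[v ->] := submx_full w fB.
by exists (lsubmx v), (rsubmx v 0 0); rewrite -mulB hsubmxK.
Qed.

Lemma tangent_normal_eq x (w w' : 'rV[R]_n.+1) :
  (forall u : 'rV[R]_n, inner gN (F x) w (u *m dmap F x)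
     = inner gN (F x) w' (u *m dmap F x)) ->
  inner gN (F x) w (nu x) = inner gN (F x) w' (nu x) -> w = w'.
Proof.
move=> tE nE; apply/eqP; rewrite -subr_eq0; apply/negPn/negP => d0.
have := riem_pos rgN (F x) d0.
have [u [a {2}->]] := tangent_normal_decomp x (w - w').
by rewrite innerDr innerZr !(innerDl, innerNl) tE nE !subrr mulr0 addr0 ltxx.
Qed.

Context {nablaN : (N -> 'rV[R]_n.+1) -> N -> 'M[R]_n.+1}.
Context {nabla : (M -> 'rV[R]_n) -> M -> 'M[R]_n}.
Context {D : (M -> 'rV[R]_n.+1) -> M -> 'M[R]_(n, n.+1)}.
Context {A : M -> 'M[R]_n}.
Hypothesis lcN : levi_civita gN nablaN.
Hypothesis lc : levi_civita g nabla.
Hypothesis pD : pullback_connection F nablaN D.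
Hypothesis soA : shape_operator F D nu A.

Local Notation push Y := (fun y => Y y *m dmap F y).

(** Uniqueness of the Levi-Civita connection: the difference of the two sides,
    as a function of [X], [Y], [Z], is symmetric in its first two arguments
    and antisymmetric in its last two, hence zero. *)
Lemma gauss_tangential (U : set M) X Y Z x : open U ->
  smooth_vf U X -> smooth_vf U Y -> smooth_vf U Z -> U x ->
  inner gN (F x) (X x *m D (push Y) x) (Z x *m dmap F x)
  = inner g x (X x *m nabla Y x) (Z x).
Proof.
move=> oU.
pose T X Y Z := inner gN (F x) (X x *m D (push Y) x) (Z x *m dmap F x)
  - inner g x (X x *m nabla Y x) (Z x).
move=> sX sY sZ Ux; apply/eqP; rewrite -subr_eq0 -/(T X Y Z).
have symT P Q S : smooth_vf U P -> smooth_vf U Q -> T P Q S = T Q P S.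
  move=> sP sQ; rewrite /T.
  have := lc_torsion_free lc oU sP sQ Ux; have := pullback_torsion sF pD lcN oU sP sQ Ux.
  rewrite /cov; move: (lie_bracket P Q x) => L.
  move=> /(canRL (subrK _)) -> /(canRL (subrK _)) ->.
  by rewrite !innerDl (ii_isometric iF _ L) opprD addrACA subrr add0r.
have antiT P Q S : smooth_vf U P -> smooth_vf U Q -> smooth_vf U S ->
    T P Q S = - T P S Q.
  move=> sP sQ sS; apply/eqP; rewrite -addr_eq0 /T addrACA -opprD.
  have := pullback_metric sF pD rgN lcN (P x) oU (smooth_along_push sF oU sQ)
    (smooth_along_push sF oU sS) Ux.
  have := lc_metric lc oU sP sQ sS Ux; rewrite /cov.
  have -> : (fun y => inner g y (Q y) (S y))
    = (fun y => inner gN (F y) (Q y *m dmap F y) (S y *m dmap F y)).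
    by apply/funext => y; exact: ii_isometric.
  move=> ->; rewrite (riem_sym rgN _ (Q x *m _)) => <-.
  by rewrite (riem_sym (ii_riemannian iF) _ (Q x)) subrr.
(* Cycle through the six orders of X, Y and Z. *)
have T0 : T X Y Z = - T X Y Z.
  rewrite [LHS](symT X Y Z)// (antiT Y X Z)// (symT Y Z X)// (antiT Z Y X)// opprK.
  by rewrite (symT Z X Y)// (antiT X Z Y).
by move/eqP: T0; rewrite -addr_eq0 -mulr2n mulrn_eq0.
Qed.

(** Differentiate [inner gN (F_* Y) nu = 0]. *)
Lemma gauss_normal (U : set M) Y x (v : 'rV[R]_n) : open U ->
  smooth_vf U Y -> U x ->
  inner gN (F x) (v *m D (push Y) x) (nu x) = inner g x (v *m A x) (Y x).
Proof.
move=> oU sY Ux.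
have sn : smooth_along F U nu by apply: smooth_along_subset (un_smooth nF).
have := pullback_metric sF pD rgN lcN v oU (smooth_along_push sF oU sY) sn Ux.
rewrite (_ : (fun y => _) = fun=> 0); last first.
  by apply/funext => y; exact: un_normal.
rewrite dfun_cst (so_weingarten soA) innerNr -(ii_isometric iF).
by move=> /esym/subr0_eq ->; exact: (riem_sym (ii_riemannian iF)).
Qed.

Lemma gauss_formula (U : set M) Y x (v : 'rV[R]_n) : open U ->
  smooth_vf U Y -> U x ->
  v *m D (push Y) x = v *m nabla Y x *m dmap F x
    + inner g x (v *m A x) (Y x) *: nu x.
Proof.
move=> oU sY Ux; apply: (@tangent_normal_eq x) => [u|]; last first.
  rewrite (gauss_normal v oU sY Ux) innerDl innerZl (un_normal nF) (un_unit nF).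
  by rewrite add0r mulr1.
rewrite innerDl innerZl (riem_sym rgN _ (nu x)) (un_normal nF) mulr0 addr0.
rewrite -(ii_isometric iF).
set c := chart_at x; have ac : atlas c := chart_at_atlas x.
have oU' : open (U `&` cdom c) by apply: openI => //; exact: cdom_open.
have sc w : smooth_vf (U `&` cdom c) (coord_field c w).
  by apply: smooth_along_subset (smooth_coord_field w ac) => y [].
have sY' : smooth_vf (U `&` cdom c) Y by apply: smooth_along_subset sY => y [].
have := gauss_tangential oU' (sc v) sY' (sc u) (conj Ux (chart_at_dom x)).
by rewrite !coord_field_at.
Qed.

End Hypersurface.

(** * The curvature of the structure vector field *)

Theorem proposition4p8 (R : realType) (n p q : nat)
    (N : manifold R n.+1) (gN J : N -> 'M[R]_n.+1)
    (nablaN : (N -> 'rV[R]_n.+1) -> N -> 'M[R]_n.+1)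
    (M : manifold R n) (F : M -> N) (nu : M -> 'rV[R]_n.+1)
    (g phi : M -> 'M[R]_n) (eta : M -> 'cV[R]_n) (xi : M -> 'rV[R]_n)
    (nabla : (M -> 'rV[R]_n) -> M -> 'M[R]_n)
    (D : (M -> 'rV[R]_n.+1) -> M -> 'M[R]_(n, n.+1)) (A : M -> 'M[R]_n) :
  locally_metallic p q gN J nablaN ->
  quadratic_metric_phi_hypersurface p q gN J F nu g phi eta xi ->
  levi_civita g nabla ->
  pullback_connection F nablaN D ->
  shape_operator F D nu A ->
  forall X Y : M -> 'rV[R]_n, smooth_vf setT X -> smooth_vf setT Y ->
  forall x : M,
    curvature nabla X Y xi x
    = p%:R *: (cov_tensor nabla X A Y x - cov_tensor nabla Y A X x)
      - (cov_tensor nabla X A Y x - cov_tensor nabla Y A X x) *m phi x.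
Proof.
move=> lm qh lc pD so X Y sX sY x.
have mr := lm_metallic lm; have rgN := mr_riemannian mr.
have lcN := lm_levi_civita lm.
have iF := qh_immersion qh; have nF := qh_normal qh; have aq := qh_structure qh.
have sF := ii_smooth iF; have cD := pb_connection pD.
have parJ := lm_parallel lm; have sJ := mr_smooth mr.
have oT : open [set: M] by exact: openT.
have sxi := aq_xi_smooth aq.
have snu := un_smooth nF.
have gsym := riem_sym (ii_riemannian iF).
pose P (V : M -> 'rV[R]_n) y := V y *m dmap F y.
have gauss V y (v : 'rV[R]_n) : smooth_vf setT V ->
    v *m D (P V) y = v *m nabla V y *m dmap F y + inner g y (v *m A y) (V y) *: nu y.
  by move=> sV; exact: (gauss_formula iF nF rgN lcN lc pD so v oT sV I).
have parallel V y (v : 'rV[R]_n) : smooth_along F setT V ->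
    v *m D (fun z => V z *m J (F z)) y = v *m D V y *m J (F y).
  by move=> sV; exact: (pullback_parallel sF pD sJ parJ v oT sV I).
(* eta is q times the dual form of xi, as J is symmetric *)
have etaE (y : M) (v : 'rV[R]_n) : form eta y v = q%:R * inner g y v (xi y).
  have : inner gN (F y) (v *m dmap F y *m J (F y)) (nu y) = form eta y v.
    by rewrite (qh_J_tangent qh) innerDl innerZl (un_normal nF) (un_unit nF) add0r mulr1.
  move=> <-; rewrite (mr_compatible mr) (qh_J_nu qh) innerDr !innerZr.
  by rewrite (un_normal nF) mulr0 addr0 (ii_isometric iF).
have q1 : q%:R = 1 :> R.
  by have := aq_eta_xi aq x; rewrite etaE (qh_xi_unit qh) mulr1.
(* Tangential and normal parts of the derivative of J nu = q xi + p nu *)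
have nabla_xi_eta y (v : 'rV[R]_n) :
    v *m nabla xi y = p%:R *: (v *m A y) - v *m A y *m phi y /\
    inner g y (v *m A y) (xi y) = - form eta y (v *m A y).
  have sPxi := smooth_along_push sF oT sxi.
  have c1 := smooth_fun_cst (M := M) setT (q%:R : R).
  have c2 := smooth_fun_cst (M := M) setT (p%:R : R).
  have := parallel nu y v snu.
  rewrite (_ : (fun z => _) = fun z => q%:R *: P xi z + p%:R *: nu z); last first.
    by apply/funext => z; rewrite (qh_J_nu qh).
  rewrite (conn_add cD oT (smooth_alongZ sF oT c1 sPxi) (smooth_alongZ sF oT c2 snu) I).
  rewrite (conn_scale cD q%:R oT sPxi I) (conn_scale cD p%:R oT snu I).
  rewrite mulmxDr -!scalemxAr (so_weingarten so) gauss// q1 scale1r.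
  rewrite mulNmx (qh_J_tangent qh) => E.
  apply: (tangent_normal_inj iF nF (x := y)).
  rewrite mulmxBl -scalemxAl scaleNr.
  move/(canRL (addrK _)): E => ->.
  by rewrite scalerN opprK opprD addrC addrA.
have etaA y (v : 'rV[R]_n) : form eta y (v *m A y) = 0.
  have [_] := nabla_xi_eta y v; rewrite etaE q1 mul1r => /eqP.
  by rewrite -addr_eq0 -mulr2n mulrn_eq0 => /eqP.
have nabla_xi (y : M) (v : 'rV[R]_n) := (nabla_xi_eta y v).1.
(* Tangential part of the derivative of F_* (nabla_V xi) = (p - J) F_* (A V)
   *)
have nabla_cov V y (v : 'rV[R]_n) : smooth_vf setT V ->
  v *m nabla (fun z => V z *m nabla xi z) y
  = p%:R *: (v *m nabla (fun z => V z *m A z) y)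
    - v *m nabla (fun z => V z *m A z) y *m phi y
    - inner g y (v *m A y) (V y *m A y) *: xi y.
  move=> sV; pose W z := V z *m A z.
  have sW : smooth_vf setT W by exact: (so_smooth so).
  have sPW := smooth_along_push sF oT sW.
  have sPWJ := smooth_along_tensor sF sJ oT sPW.
  have sWphi : smooth_vf setT (fun z => W z *m phi z) by exact: (aq_phi_smooth aq).
  have c1 := smooth_fun_cst (M := M) setT (-1 : R).
  have c2 := smooth_fun_cst (M := M) setT (p%:R : R).
  have VE : (fun z => V z *m nabla xi z) = (fun z => p%:R *: W z + -1 *: (W z *m phi z)).
    by apply/funext => z; rewrite nabla_xi scaleN1r.
  have sid := smooth_map_id M.
  have sVn : smooth_vf setT (fun z => V z *m nabla xi z).
    rewrite VE; apply: (smooth_alongD sid oT); first exact: (smooth_alongZ sid oT c2 sW).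
    exact: (smooth_alongZ sid oT c1 sWphi).
  have PE : P (fun z => V z *m nabla xi z)
      = (fun z => p%:R *: P W z + -1 *: (P W z *m J (F z))).
    apply/funext => z; rewrite /P (congr1 (@^~ z) VE) (qh_J_tangent qh) etaA.
    by rewrite scale0r addr0 mulmxDl -!scalemxAl.
  have := gauss _ y v sVn; rewrite PE.
  rewrite (conn_add cD oT (smooth_alongZ sF oT c2 sPW) (smooth_alongZ sF oT c1 sPWJ) I).
  rewrite (conn_scale cD p%:R oT sPW I) (conn_scale cD (-1) oT sPWJ I).
  rewrite mulmxDr -!scalemxAr parallel// gauss//.
  set Z := v *m nabla _ y; set a := inner _ _ _ _; set b := inner _ _ _ _.
  rewrite mulmxDl (qh_J_tangent qh) -scalemxAl (qh_J_nu qh) q1 scale1r => E.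
  have [] := @tangent_normal_inj _ _ _ _ _ _ _ _ iF nF y
    (p%:R *: Z - Z *m phi y - a *: xi y) (v *m nabla (fun z => V z *m nabla xi z) y)
    (p%:R * a - form eta y Z - a * p%:R) b; last by [].
  rewrite -E !mulmxBl -!scalemxAl.
  have alg (c e f : R) (B1 B2 B3 B4 : 'rV[R]_n.+1) :
      c *: B1 - B2 - e *: B3 + (c * e - f - e * c) *: B4
      = c *: (B1 + e *: B4) + -1 *: (B2 + f *: B4 + e *: (B3 + c *: B4)).
    by apply/rowP => j; rewrite !mxE; ring.
  exact: alg.
rewrite /curvature /cov.
have LE := lc_torsion_free lc oT sX sY I; rewrite /cov in LE.
rewrite !nabla_cov// nabla_xi -LE /cov_tensor /cov.
rewrite (gsym _ (Y x *m A x)).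
rewrite !mulmxBl.
have alg (c : R) (Z1 Z2 U1 U2 S Z1' Z2' U1' U2' : 'rV[R]_n) :
    c *: Z1 - Z1' - S - (c *: Z2 - Z2' - S) - (c *: (U1 - U2) - (U1' - U2'))
    = c *: (Z1 - U1 - (Z2 - U2)) - (Z1' - U1' - (Z2' - U2')).
  by apply/rowP => j; rewrite !mxE; ring.
exact: alg.
Qed.
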